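(* Let $\mathbb F$ be a field of characteristic $0$, let $\mathbbm r$ be a noncommutative rational function over $\mathbb F$ in $z_1,\dots,z_g$, let $\underline p\in\operatorname{dom}_m\mathbbm r$ and let $(\mathbf c,A,\mathbf b)$ be a totally reduced realization of $\mathbbm r$ about $\underline p$, of dimension $n$. Then $$\operatorname{edom}^{\mathrm{st}}_{ms}\mathbbm r=\left\{\underline q\in M_{ms}(\mathbb F)^g:\ \det\left(I_{msn}-\sum_{j=1}^g\iota(A^{x_j})(q_j-\iota(p_j))\right)\ne0\right\}$$ for all $s\in\mathbb N$, where $\iota:M_m(\mathbb F)\to M_{ms}(\mathbb F)$ is the embedding $a\mapsto I_s\otimes a$.
   Context: Rational expressions and functions: $\mathcal R_{\mathbb F}(\underline z)$ is the set of syntactically valid combinations of noncommutative polynomials over $\mathbb F$ in $\underline z=\{z_1,\dots,z_g\}$, operations $+,\cdot,{}^{-1}$ and parentheses. For $\underline a\in M_m(\mathbb F)^g$, $r(\underline a)$ is obtained by replacing $z_j$ by $a_j$ and $1$ by $I_m$; $\operatorname{dom}_m r\subseteq M_m(\mathbb F)^g$ is the set of $\underline a$ at which all inverses occurring in $r$ exist; $\operatorname{dom}r=\bigcup_m\operatorname{dom}_mr$. $r$ is nondegenerate if $\operatorname{dom}r\ne\emptyset$. Nondegenerate $r_1,r_2$ are equivalent if they agree on $\operatorname{dom}r_1\cap\operatorname{dom}r_2$; noncommutative rational functions are the equivalence classes. $\operatorname{dom}_m\mathbbm r$ is the union of $\operatorname{dom}_mr$ over all representatives $r$ of $\mathbbm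 r$. Stable extended domain: let $T_k=(t^{(k)}_{ij})_{ij}$, $1\le k\le g$, be generic $m\times m$ matrices whose entries are independent commuting indeterminates. If $r(T_1,\dots,T_g)\in M_m(\mathbb F(\underline t))$ exists, $\operatorname{edom}_mr\subseteq M_m(\mathbb F)^g$ is the intersection of the domains of regularity of its entries (commutative rational functions). $\operatorname{edom}^{\mathrm{st}}_mr$ is the set of $\underline a\in\operatorname{edom}_mr$ such that $\underline a\oplus\cdots\oplus\underline a$ ($k$ summands) lies in $\operatorname{edom}_{km}r$ for all $k\in\mathbb N$, and $\operatorname{edom}^{\mathrm{st}}_m\mathbbm r$ is the union of $\operatorname{edom}^{\mathrm{st}}_mr$ over representatives $r$ of $\mathbbm r$. Realizations: let $\mathcal A=M_m(\mathbb F)$, let $\underline x=\{x_1,\dots,x_g\}$ be freely noncommuting letters, $\mathcal A\langle\underline x\rangle=\mathcal A*_{\mathbb F}\mathbb F\langle\underline x\rangle$, with $(\underline x)$-adic completion $\mathcal A\langle\!\langle\underline x\rangle\!\rangle$. For a word $w=w_1\cdots w_\ell$, $\mathcal A^w$ is the $\mathbb F$-span of all $a_0w_1a_1\cdots w_\ell a_\ell$, $a_i\in\mathcal A$; every series is uniquely $S=\sum_w[S,w]$, $[S,w]\in\mathcal A^w$. A representation of dimension $n$ of $S$ is $(\mathbf c,A,\mathbf b)$ with $\mathbf c\in\mathcal A^{1\times n}$, $\mathbf b\in\mathcal A^{n\times1}$, $A^{x}\in(\mathcal A^{x})^{n\times n}$ and $[S,w]=\mathbf cA^w\mathbf b$ for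 all $w$, where $A^w=A^{w_1}\cdots A^{w_{|w|}}$; it is totally reduced if $\{\mathbf u\in\mathcal A^{1\times n}:\mathbf uA^w\mathbf b=0\ \forall w\}=0$ and $\{\mathbf v\in\mathcal A^{n\times1}:\mathbf cA^w\mathbf v=0\ \forall w\}=0$. A realization of $\mathbbm r$ about $\underline p\in\operatorname{dom}_m\mathbbm r$ is a representation of the expansion $r(x_1+p_1,\dots,x_g+p_g)\in\mathcal A\langle\!\langle\underline x\rangle\!\rangle$, for any representative $r$ of $\mathbbm r$ defined at $\underline p$ (the expansion does not depend on $r$). For $q\in M_{ms}(\mathbb F)$, $\iota(A^{x_j})(q)$ is the $n\times n$ matrix over $M_{ms}(\mathbb F)$ obtained from $A^{x_j}$ by replacing each term $a\,x_j\,b$ ($a,b\in M_m(\mathbb F)$) of its entries by $\iota(a)\,q\,\iota(b)$; it is regarded as an $msn\times msn$ matrix over $\mathbb F$. *)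

(* Defs.v *)
From HB Require Import structures.
From mathcomp Require Import all_boot all_order all_algebra.
From mathcomp Require Import boolp.
From mathcomp Require Import mxtens.
From mathcomp Require Import mpoly.

Set Implicit Arguments.
Unset Strict Implicit.
Unset Printing Implicit Defensive.

Import GRing.Theory.
Local Open Scope ring_scope.

(* Noncommutative polynomials are the inverse-free expressions. *)
Inductive rexpr (F : Type) (g : nat) : Type :=
  | RConst of F
  | RVar of 'I_g
  | RAdd of rexpr F g & rexpr F g
  | RMul of rexpr F g & rexpr F g
  | RInv of rexpr F g.

(* [rvalue phi z r v]: every inverse occurring in r exists when the variables
   are replaced by z in the ring B, and the resulting value is v.  The scalars
   of r are mapped to B by phi. *)
Inductive rvalue (F : Type) (g : nat) (B : pzRingType) (phi : F -> B)
    (z : 'I_g -> B) : rexpr F g -> B -> Prop :=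
  | RvConst c : rvalue phi z (RConst g c) (phi c)
  | RvVar j : rvalue phi z (RVar F j) (z j)
  | RvAdd r1 r2 v1 v2 : rvalue phi z r1 v1 -> rvalue phi z r2 v2 ->
      rvalue phi z (RAdd r1 r2) (v1 + v2)
  | RvMul r1 r2 v1 v2 : rvalue phi z r1 v1 -> rvalue phi z r2 v2 ->
      rvalue phi z (RMul r1 r2) (v1 * v2)
  | RvInv r v v' : rvalue phi z r v -> v * v' = 1 -> v' * v = 1 ->
      rvalue phi z (RInv r) v'.

Lemma rvalue_uniq (F : Type) g (B : pzRingType) (phi : F -> B) (z : 'I_g -> B)
    r v1 v2 : rvalue phi z r v1 -> rvalue phi z r v2 -> v1 = v2.
Proof.
move=> v1P; elim: {r v1}v1P v2 => [c|j|r1 r2 a b _ IHa _ IHb|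
  r1 r2 a b _ IHa _ IHb|r a a' _ IHa aK Ka] v2 v2P; inversion v2P => //; subst.
- by rewrite (IHa _ H1) (IHb _ H3).
- by rewrite (IHa _ H1) (IHb _ H3).
- have Ev := IHa _ H0; rewrite -Ev in H1.
  by rewrite -[a']mulr1 -H1 mulrA Ka mul1r.
Qed.

Section RationalFunctions.
Variables (F : fieldType) (g : nat).
Implicit Types (r : rexpr F g) (m : nat).

Definition mxvalue m (a : 'I_g -> 'M[F]_m) : rexpr F g -> 'M[F]_m -> Prop :=
  rvalue (fun c : F => c%:M : 'M[F]_m) a.

Definition rdom m r (a : 'I_g -> 'M[F]_m) : Prop := exists v, mxvalue a r v.

(* Size 0 is excluded: every expression is defined on 0 x 0 matrices. *)
Definition nondegenerate r : Prop :=
  exists m, (0 < m)%N /\ exists a : 'I_g -> 'M[F]_m, rdom r a.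

Definition requiv r1 r2 : Prop :=
  forall m, (0 < m)%N -> forall (a : 'I_g -> 'M[F]_m) v1 v2,
    mxvalue a r1 v1 -> mxvalue a r2 v2 -> v1 = v2.

Record ncratfun : Type := NCRatFun {
  rep : rexpr F g -> Prop;
  rep_class : exists2 r0, nondegenerate r0 &
    forall r, rep r <-> nondegenerate r /\ requiv r0 r
}.

Definition ncdom (rr : ncratfun) m (a : 'I_g -> 'M[F]_m) : Prop :=
  exists2 r, rep rr r & rdom r a.

(* t_(k, i, j) is the (i, j) entry of the k-th generic m x m matrix. *)
Definition tindex m : finType := ('I_g * 'I_m * 'I_m)%type.

Definition tpoly m : idomainType := {mpoly F[#|tindex m|]}.

Definition tfrac m : fieldType := {fraction tpoly m}.

Definition generic_mx m (k : 'I_g) : 'M[tfrac m]_m :=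
  \matrix_(i, j) tofrac ('X_(enum_rank ((k, i, j) : tindex m)) : tpoly m).

Definition generic_value m : rexpr F g -> 'M[tfrac m]_m -> Prop :=
  rvalue (fun c : F => (tofrac (c%:MP : tpoly m))%:M : 'M[tfrac m]_m)
         (@generic_mx m).

Definition tpoint m (a : 'I_g -> 'M[F]_m) (v : 'I_#|tindex m|) : F :=
  let: (k, i, j) := enum_val v in a k i j.

Definition regular_at m (f : tfrac m) (a : 'I_g -> 'M[F]_m) : Prop :=
  exists P Q : {mpoly F[#|tindex m|]},
    Q.@[tpoint a] != 0 /\ f = tofrac (P : tpoly m) / tofrac (Q : tpoly m).

(* Empty when r cannot be evaluated at the generic m x m matrices. *)
Definition edom m r (a : 'I_g -> 'M[F]_m) : Prop :=
  exists2 R, generic_value r R & forall i j, regular_at (R i j) a.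

End RationalFunctions.

(* I_s (x) a, that is the block diagonal matrix with s diagonal blocks a. *)
Definition iota_mx (R : pzRingType) (m s : nat) (a : 'M[R]_m) : 'M[R]_(s * m) :=
  (1%:M : 'M[R]_s) *t a.

Section StableExtendedDomain.
Variables (F : fieldType) (g : nat).

Definition edom_st m (r : rexpr F g) (a : 'I_g -> 'M[F]_m) : Prop :=
  edom r a /\ forall k, (0 < k)%N -> edom r (fun j => iota_mx k (a j)).

Definition ncedom_st (rr : ncratfun F g) m (a : 'I_g -> 'M[F]_m) : Prop :=
  exists2 r, rep rr r & edom_st r a.

End StableExtendedDomain.

(* Writing e_ij for the matrix units of A = M_m(F), the F-space A^w with
   w = w_1 ... w_l has the basis
     e_(i,j0) w_1 e_(i1,j1) w_2 ... w_l e_(il,j),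
   encoded here as the word of letters (j0,w_1,i1) (j1,w_2,i2) ... (..,w_l,il)
   together with the outer indices i, j.  A series in A<<x>> is the family of
   its coordinates: [gcoef S s i j] is the coefficient of the basis monomial
   with word s and outer indices i, j.  As e_ij e_kl = (j == k) e_il, the
   product concatenates words and multiplies matrices. *)
Definition gletter (g m : nat) : eqType := ('I_m * 'I_g * 'I_m)%type.

Definition gword g m (s : seq (gletter g m)) : seq 'I_g :=
  [seq l.1.2 | l <- s].

Record gseries (F : Type) (g m : nat) : Type :=
  GSeries { gcoef : seq (gletter g m) -> 'M[F]_m }.

Lemma gseriesP (F : Type) (g m : nat) (S T : gseries F g m) :
  gcoef S =1 gcoef T -> S = T.
Proof. by case: S => S; case: T => T /= /funext ->. Qed.

HB.instance Definition _ (F : Type) (g m : nat) := gen_eqMixin (gseries F g m).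
HB.instance Definition _ (F : Type) (g m : nat) :=
  gen_choiceMixin (gseries F g m).

Section SeriesRing.
Variables (F : fieldType) (g m : nat).
Implicit Types S T U : gseries F g m.

Definition gzero : gseries F g m := GSeries (fun=> 0).
Definition gopp S := GSeries (fun s => - gcoef S s).
Definition gadd S T := GSeries (fun s => gcoef S s + gcoef T s).

Definition gconst (a : 'M[F]_m) : gseries F g m :=
  GSeries (fun s => if s is [::] then a else 0).

Definition gmul S T := GSeries (fun s =>
  \sum_(d < (size s).+1) gcoef S (take d s) *m gcoef T (drop d s)).

Fact gaddA : associative gadd.
Proof. by move=> S T U; apply: gseriesP => s /=; rewrite addrA. Qed.
Fact gaddC : commutative gadd.
Proof. by move=> S T; apply: gseriesP => s /=; rewrite addrC. Qed.
Fact gadd0 : left_id gzero gadd.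
Proof. by move=> S; apply: gseriesP => s /=; rewrite add0r. Qed.
Fact gaddN : left_inverse gzero gopp gadd.
Proof. by move=> S; apply: gseriesP => s /=; rewrite addNr. Qed.

HB.instance Definition _ :=
  GRing.isZmodule.Build (gseries F g m) gaddA gaddC gadd0 gaddN.

Let gtail S l := GSeries (fun s => gcoef S (l :: s)).

Fact gmul_nil S T : gcoef (gmul S T) [::] = gcoef S [::] *m gcoef T [::].
Proof. by rewrite /= big_ord1. Qed.

Fact gmul_cons S T l s : gcoef (gmul S T) (l :: s) =
  gcoef S [::] *m gcoef T (l :: s) + gcoef (gmul (gtail S l) T) s.
Proof. by rewrite /= big_ord_recl. Qed.

Fact gmulDl : left_distributive gmul gadd.
Proof.
move=> S T U; apply: gseriesP => s /=; rewrite -big_split /=.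
by apply: eq_bigr => d _; rewrite mulmxDl.
Qed.
Fact gmulDr : right_distributive gmul gadd.
Proof.
move=> S T U; apply: gseriesP => s /=; rewrite -big_split /=.
by apply: eq_bigr => d _; rewrite mulmxDr.
Qed.

Let gscale (a : 'M[F]_m) S := GSeries (fun s => a *m gcoef S s).

Let gmulZl a S T s :
  gcoef (gmul (gscale a S) T) s = a *m gcoef (gmul S T) s.
Proof. by rewrite /= mulmx_sumr; apply: eq_bigr => d _; rewrite mulmxA. Qed.

Fact gmulA : associative gmul.
Proof.
move=> S T U; apply: gseriesP => s; elim: s S T => [|l s IHs] S T.
  by rewrite !gmul_nil mulmxA.
rewrite !gmul_cons gmul_nil.
have -> : gtail (gmul S T) l =
    gadd (gscale (gcoef S [::]) (gtail T l)) (gmul (gtail S l) T).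
  by apply: gseriesP => t; rewrite /gtail [LHS]gmul_cons.
have gaddE S1 S2 t : gcoef (gadd S1 S2) t = gcoef S1 t + gcoef S2 t by [].
by rewrite gmulDl gaddE gmulZl IHs mulmxDr mulmxA addrA.
Qed.

Fact gmul1l : left_id (gconst 1%:M) gmul.
Proof.
move=> S; apply: gseriesP => s /=; rewrite big_ord_recl take0 drop0 mul1mx.
rewrite big1 ?addr0 // => d _; case: s d => [|l s] d /=; first by case: d.
by rewrite mul0mx.
Qed.
Fact gmul1r : right_id (gconst 1%:M) gmul.
Proof.
move=> S; apply: gseriesP => s /=.
rewrite big_ord_recr /= take_size drop_size mulmx1 big1 ?add0r // => d _.
case: (drop d s) (size_drop d s) => [/eqP|l t _]; last by rewrite mulmx0.
by rewrite eq_sym subn_eq0 leqNgt ltn_ord.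
Qed.

HB.instance Definition _ := GRing.Zmodule_isPzRing.Build (gseries F g m)
  gmulA gmul1l gmul1r gmulDl gmulDr.

(* x_k is the sum over i, j of e_ii x_k e_jj. *)
Definition gvar (k : 'I_g) : gseries F g m := GSeries (fun s =>
  if s is [:: (i, k', j)] then if k' == k then delta_mx i j else 0 else 0).

(* [S, w] *)
Definition gcomp S (w : seq 'I_g) : gseries F g m :=
  GSeries (fun s => if gword s == w then gcoef S s else 0).

(* S lies in A^w. *)
Definition in_comp (w : seq 'I_g) S : Prop := gcomp S w = S.

(* Replaces each a x_k b by iota(a) Q iota(b) in an element T of A^(x_k), through
   the expansion of T in the basis e_iu x_k e_vj; see in_comp_letterP, gsubstD
   and gsubst_term below. *)
Definition gsubst s (k : 'I_g) (Q : 'M[F]_(s * m)) T : 'M[F]_(s * m) :=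
  \sum_u \sum_v \sum_i \sum_j gcoef T [:: (u, k, v)] i j *:
    (iota_mx s (delta_mx i u) *m Q *m iota_mx s (delta_mx v j)).

Lemma gcoef_sum (I : Type) (t : seq I) (S : I -> gseries F g m) s :
  gcoef (\sum_(x <- t) S x) s = \sum_(x <- t) gcoef (S x) s.
Proof. by elim/big_rec2: _ => // i S1 S2 _ <-. Qed.

Lemma gcoef_term (a b : 'M[F]_m) k s : gcoef (gconst a * gvar k * gconst b) s =
  if s is [:: (u, k', v)] then
    if k' == k then a *m delta_mx u v *m b else 0 else 0.
Proof.
have gconstl S t : gcoef (gconst a * S) t = a *m gcoef S t.
  rewrite /= big_ord_recl take0 drop0 big1 ?addr0 // => d _.
  by case: t d => [|l t] d /=; [case: d | rewrite mul0mx].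
have gconstr S t : gcoef (S * gconst b) t = gcoef S t *m b.
  rewrite /= big_ord_recr /= take_size drop_size big1 ?add0r // => d _.
  case: (drop d t) (size_drop d t) => [/eqP|l t' _]; last by rewrite mulmx0.
  by rewrite eq_sym subn_eq0 leqNgt ltn_ord.
rewrite gconstr gconstl; case: s => [|[[u k'] v] [|l s]] /=.
- by rewrite mulmx0 mul0mx.
- by case: (k' == k); rewrite // mulmx0 mul0mx.
- by rewrite mulmx0 mul0mx.
Qed.

Lemma in_comp_letterP (k : 'I_g) T : in_comp [:: k] T <->
  exists ab : seq ('M[F]_m * 'M[F]_m),
    T = \sum_(t <- ab) gconst t.1 * gvar k * gconst t.2.
Proof.
split=> [TkE|[ab ->]]; last first.
  apply: gseriesP => s; rewrite [LHS]/= gcoef_sum; case: eqP => // Nsk.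
  rewrite big1 // => t _; rewrite gcoef_term.
  case: s Nsk => [|[[u k'] v] [|l s]] //; case: eqP => // -> Nsk.
  by case: Nsk.
pose t (x : 'I_m * 'I_m * 'I_m) : 'M[F]_m * 'M[F]_m :=
  (delta_mx x.2 x.1.1, delta_mx x.1.2 x.2 *m gcoef T [:: (x.1.1, k, x.1.2)]).
exists [seq t x | x <- enum {: 'I_m * 'I_m * 'I_m}].
rewrite big_map big_enum /=; apply: gseriesP => s; rewrite gcoef_sum.
rewrite -[in LHS]TkE [LHS]/=; under eq_bigr do rewrite gcoef_term.
case: s => [|[[u k'] v] [|l s]] /=; rewrite ?big1_eq //; last first.
  by case: eqP.
rewrite eqseq_cons andbT /=; case: eqP => [->|_]; last by rewrite big1_eq.
rewrite -(pair_bigA _ (fun x i => delta_mx i x.1 *m delta_mx u v *m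
  (delta_mx x.2 i *m gcoef T [:: (x.1, k, x.2)]))) /=.
rewrite (bigD1 (u, v)) //= [X in _ + X]big1 ?addr0.
  under eq_bigr do rewrite mulmxA mul_delta_mx mul_delta_mx.
  by rewrite -mulmx_suml -mx1_sum_delta mul1mx.
move=> [u' v'] Nuv; apply: big1 => i _; rewrite mulmxA.
rewrite mul_delta_mx_cond; case: (u' =P u) Nuv => [->|_ _].
  rewrite mulr1n xpair_eqE eqxx /= eq_sym => Nv.
  by rewrite mul_delta_mx_cond (negPf Nv) mul0mx.
by rewrite !mul0mx.
Qed.

Lemma gsubstD s k (Q : 'M[F]_(s * m)) S T :
  gsubst k Q (S + T) = gsubst k Q S + gsubst k Q T.
Proof.
rewrite /gsubst; do 4!(rewrite -big_split; apply: eq_bigr => ? _ /=).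
by rewrite mxE scalerDl.
Qed.

Lemma gsubst_term s k (Q : 'M[F]_(s * m)) a b :
  gsubst k Q (gconst a * gvar k * gconst b) =
  iota_mx s a *m Q *m iota_mx s b.
Proof.
have iotaE (X : 'M[F]_m) : iota_mx s X =
    \sum_i \sum_j X i j *: iota_mx s (delta_mx i j).
  apply/matrixP => x y; rewrite summxE /iota_mx !mxE.
  under eq_bigr do rewrite summxE; under eq_bigr do under eq_bigr do
    rewrite !mxE mulrCA.
  under eq_bigr do rewrite -mulr_sumr; rewrite -mulr_sumr; congr (_ * _).
  rewrite [in LHS](matrix_sum_delta X) summxE; apply: eq_bigr => i _.
  by rewrite summxE; apply: eq_bigr => j _; rewrite !mxE.
rewrite (iotaE a) (iotaE b) exchange_big !mulmx_suml /=.
apply: eq_bigr => u _; rewrite mulmx_sumr; apply: eq_bigr => v _.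
rewrite mulmx_suml mulmx_suml; apply: eq_bigr => i _.
rewrite mulmx_sumr; apply: eq_bigr => j _.
rewrite gcoef_term eqxx -!scalemxAl -scalemxAr scalerA; congr (_ *: _).
rewrite mxE (bigD1 v) //= big1 ?addr0 => [|v' Nv]; last first.
  rewrite mxE big1 ?mul0r // => u' _.
  by rewrite mxE (negPf Nv) andbF mulr0.
rewrite mxE (bigD1 u) //= big1 ?addr0 => [|u' Nu]; last first.
  by rewrite mxE (negPf Nu) mulr0.
by rewrite mxE !eqxx mulr1.
Qed.

End SeriesRing.
Arguments gconst {F g m} a.
Arguments gvar {F g m} k.

Section Realizations.
Variables (F : fieldType) (g m n : nat).
Implicit Types (A : 'I_g -> 'M[gseries F g m]_n).

Definition gconst_mx k l (B : 'M['M[F]_m]_(k, l)) : 'M[gseries F g m]_(k, l) :=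
  map_mx gconst B.

Definition wordmx A (w : seq 'I_g) : 'M[gseries F g m]_n := \prod_(k <- w) A k.

Definition representation (S : gseries F g m)
    (c : 'rV['M[F]_m]_n) A (b : 'cV['M[F]_m]_n) : Prop :=
  (forall k i j, in_comp [:: k] (A k i j)) /\
  forall w, gcomp S w = (gconst_mx c *m wordmx A w *m gconst_mx b) 0 0.

Definition totally_reduced
    (c : 'rV['M[F]_m]_n) A (b : 'cV['M[F]_m]_n) : Prop :=
  (forall u : 'rV['M[F]_m]_n,
     (forall w, gconst_mx u *m wordmx A w *m gconst_mx b = 0) -> u = 0) /\
  (forall v : 'cV['M[F]_m]_n,
     (forall w, gconst_mx c *m wordmx A w *m gconst_mx v = 0) -> v = 0).

(* S is the expansion r(x_1 + p_1, ..., x_g + p_g). *)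
Definition expansion (r : rexpr F g) (p : 'I_g -> 'M[F]_m)
    (S : gseries F g m) : Prop :=
  rvalue (fun c : F => gconst c%:M) (fun k => gvar k + gconst (p k)) r S.

Definition realization (rr : ncratfun F g) (p : 'I_g -> 'M[F]_m)
    (c : 'rV['M[F]_m]_n) A (b : 'cV['M[F]_m]_n) : Prop :=
  exists r S, [/\ rep rr r, rdom r p, expansion r p S & representation S c A b].

(* The n x n matrix iota(A^(x_k))(Q), flattened to a matrix over F. *)
Definition gsubst_mx s A (k : 'I_g) (Q : 'M[F]_(s * m)) :
    'M[F]_(\sum_(i < n) s * m) :=
  \mxblock_(i < n, j < n) gsubst k Q (A k i j).

End Realizations.

(* Main.v *)
Require Import Defs.
From HB Require Import structures.
From mathcomp Require Import all_boot all_order all_algebra.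
From mathcomp Require Import boolp mxtens mpoly.

Set Implicit Arguments.
Unset Strict Implicit.
Unset Printing Implicit Defensive.

Import GRing.Theory.
Local Open Scope ring_scope.

(** The algebra of sm x sm matrices is the tensor product of the algebra of
    s x s matrices and that of m x m matrices, so g matrix variables T_k of size
    sm amount to g m^2 variables of size s, the blocks of the T_k.  With respect
    to the matrix units of M_m, the realization (c, A, b) becomes an ordinary
    realization over F in the letters (u, k, v): the coefficient of a word w is
    c X_w b, where X_w is a product of square matrices X_l of size nm
    ([flat_realization]).  Totally reduced means that this realization is
    observable and controllable ([flat_observable], [flat_controllable]).  Put
    y_l for the blocks of T_k - iota(p_k) and L = 1 - sum_l y_l (x) X_l; at
    T = q, this pencil is a rearrangement of the matrix whose determinant the
    theorem is about ([flat_pencil_unit]).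

    The value of r at generic matrices is (1 (x) c) L^-1 (1 (x) b), because both
    sides are rational and have the same expansion along every line through
    iota(p) ([generic_formula]).  The determinant of L is thus a common
    denominator of this value.  If it does not vanish at q, it does not vanish
    at I_k (x) q either, and q lies in the stable extended domain of the
    representative that is defined at p ([edom_of_unit]).

    Conversely, let q lie in the stable extended domain of a representative.
    All representatives have the same generic values ([requiv_trans],
    [generic_value_equiv]; this is where the field has to be infinite), so
    (1 (x) c) L^-1 (1 (x) b) is regular at I_k (x) q for every k.  Fix two words
    w and w', and consider block matrices depending on two parameters t and h:
    block upper bidiagonal, with diagonal blocks t y(q), except one of them which
    is (1 - h) y(q), and with superdiagonal blocks 1 - t, placed in the letters of
    the words w and w'.  At t = 1, h = 0 this is I_k (x) q, where a suitable
    denominator does not vanish: hence it is not divisible by h.  Let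
    L_h = 1 - (1 - h) sum_l y_l(q) (x) X_l, and let h^e be the exact power of h
    that divides det L_h.  Since h^e divides the determinant of the whole pencil,
    it divides the numerator of its inverse, first for generic t and then for
    t = 0 ([reach_vanishes]).  At t = 0 all diagonal blocks but one sit at p, and
    a corner of the numerator is (1 (x) c X_w) adj(L_h) (1 (x) X_w' b).  As w and
    w' vary, observability and controllability show that h^e divides adj(L_h).
    Dividing L_h adj(L_h) = det L_h by h^e and putting h = 0 gives the
    invertibility of L at q ([pencil_unit]). *)

(** * Values of rational expressions *)

Lemma rvalue_map (F : Type) g (B B' : pzRingType) (phi : F -> B)
    (z : 'I_g -> B) (phi' : F -> B') (z' : 'I_g -> B')
    (Psi : {rmorphism B -> B'}) r v :
  (forall c, phi' c = Psi (phi c)) -> (forall j, z' j = Psi (z j)) ->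
  rvalue phi z r v -> rvalue phi' z' r (Psi v).
Proof.
move=> phiE zE; elim=> {r v} [c|j|r1 r2 v1 v2 _ IH1 _ IH2|
  r1 r2 v1 v2 _ IH1 _ IH2|r v v' _ IH vK Kv].
- by rewrite -phiE; apply: RvConst.
- by rewrite -zE; apply: RvVar.
- by rewrite rmorphD; apply: RvAdd.
- by rewrite rmorphM; apply: RvMul.
- by apply: RvInv IH _ _; rewrite -rmorphM (vK, Kv) rmorph1.
Qed.

(** Scalars and variables need not be central in the ring of values, so the
    common denominators used below have to be moved past a value by means of
    this lemma. *)
Lemma rvalue_comm (F : Type) g (B : pzRingType) (phi : F -> B)
    (z : 'I_g -> B) x r v :
  (forall c, GRing.comm x (phi c)) -> (forall j, GRing.comm x (z j)) ->
  rvalue phi z r v -> GRing.comm x v.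
Proof.
move=> cphi cz; elim=> {r v} // [r1 r2 v1 v2 _ IH1 _ IH2|
  r1 r2 v1 v2 _ IH1 _ IH2|r v v' _ IH vK Kv].
- exact: commrD.
- exact: commrM.
- by rewrite /GRing.comm -[x * v']mul1r -Kv -mulrA (mulrA v) -IH -!mulrA vK mulr1.
Qed.

Section ClearDenominators.
Variables (F : fieldType) (g N : nat).
Local Notation poly := (tpoly F g N).

Definition var_mx (k : 'I_g) : 'M[poly]_N :=
  \matrix_(i, j) ('X_(enum_rank ((k, i, j) : tindex g N)) : poly).

Definition pconst (c : F) : poly := c%:MP.

HB.instance Definition _ :=
  GRing.RMorphism.copy pconst (@mpolyC #|tindex g N| F).

Definition pvalue (B : pzRingType) (T : {rmorphism 'M[poly]_N -> B}) :=
  rvalue (fun c => T (pconst c)%:M) (fun k => T (var_mx k)).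

Lemma pvalue_map (K : comNzRingType) (theta : {rmorphism poly -> K}) 
    (phi : F -> 'M[K]_N) z r v :
  (forall c, phi c = (theta (pconst c))%:M) ->
  (forall k, z k = map_mx theta (var_mx k)) ->
  rvalue phi z r v <-> pvalue (map_mx theta) r v.
Proof.
move=> phiE zE; split.
- by apply: (rvalue_map (Psi := idfun)) => *; rewrite /= ?phiE ?zE ?map_scalar_mx.
- by apply: (rvalue_map (Psi := idfun)) => *; rewrite /= ?phiE ?zE ?map_scalar_mx.
Qed.

Lemma scalar_mx_comm (D : poly) (A : 'M[poly]_N) : GRing.comm D%:M A.
Proof. by rewrite /GRing.comm -!mulmxE scalar_mxC. Qed.

Lemma pvalue_comm (B : pzRingType) (T : {rmorphism 'M[poly]_N -> B}) D r v :
  pvalue T r v -> GRing.comm (T D%:M) v.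
Proof.
by apply: rvalue_comm => * /=; rewrite /GRing.comm -2!rmorphM scalar_mx_comm.
Qed.

(** The denominator D collects the determinants of all the values that get
    inverted.  Wherever D does not vanish the expression is therefore defined,
    and in any ring receiving the polynomial matrices a value, if there is one,
    is P / D.  In the last clause D may be a non-invertible element, and the
    ring may be noncommutative: it will be applied to power series. *)
Lemma clear_denominators (K : fieldType) (theta : {rmorphism poly -> K}) r v :
  pvalue (map_mx theta) r v ->
  exists (D : poly) (P : 'M[poly]_N), [/\ theta D != 0,
    forall (K' : fieldType) (theta' : {rmorphism poly -> K'}),
      theta' D != 0 -> exists v', pvalue (map_mx theta') r v'
  & forall (B : pzRingType) (T : {rmorphism 'M[poly]_N -> B}) v',
      pvalue T r v' -> T D%:M * v' = T P].
Proof.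
elim=> {r v} [c|k|r1 r2 v1 v2 _ [D1 [P1 [D1n ex1 val1]]] _
  [D2 [P2 [D2n ex2 val2]]]|r1 r2 v1 v2 _ [D1 [P1 [D1n ex1 val1]]] _
  [D2 [P2 [D2n ex2 val2]]]|r v v' rv [D [P [Dn ex val]]] vK Kv].
- exists 1, (pconst c)%:M; split=> [|K' t' _|B T v']; first by rewrite rmorph1 oner_eq0.
    by exists (map_mx t' (pconst c)%:M); apply: RvConst.
  by move=> v'P; inversion v'P; rewrite rmorph1 mul1r.
- exists 1, (var_mx k); split=> [|K' t' _|B T v']; first by rewrite rmorph1 oner_eq0.
    by exists (map_mx t' (var_mx k)); apply: RvVar.
  by move=> v'P; inversion v'P; rewrite rmorph1 mul1r.
- exists (D1 * D2), (D2%:M * P1 + D1%:M * P2); split=> [|K' t'|B T v'].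
  + by rewrite rmorphM mulf_neq0.
  + rewrite rmorphM mulf_eq0 negb_or => /andP[/ex1[w1 w1P] /ex2[w2 w2P]].
    by exists (w1 + w2); apply: RvAdd.
  + move=> v'P; inversion v'P; subst.
    rewrite scalar_mxM rmorphD !(rmorphM T) -(val1 _ _ _ H1) -(val2 _ _ _ H3).
    by rewrite mulrDr !mulrA -!(rmorphM T) scalar_mx_comm.
- exists (D1 * D2), (P1 * P2); split=> [|K' t'|B T v'].
  + by rewrite rmorphM mulf_neq0.
  + rewrite rmorphM mulf_eq0 negb_or => /andP[/ex1[w1 w1P] /ex2[w2 w2P]].
    by exists (w1 * w2); apply: RvMul.
  + move=> v'P; inversion v'P; subst.
    rewrite scalar_mxM !(rmorphM T) -(val1 _ _ _ H1) -(val2 _ _ _ H3).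
    by rewrite -!mulrA; congr (_ * _); rewrite !mulrA (pvalue_comm D2 H1).
- have det_neq0 (K' : fieldType) (t' : {rmorphism poly -> K'}) w : t' D != 0 ->
      pvalue (map_mx t') r w -> (t' (\det P) != 0) = (w \in unitmx).
    move=> t'D /val/(congr1 determinant); rewrite /= map_scalar_mx -mulmxE.
    rewrite det_mulmx det_scalar det_map_mx => <-.
    by rewrite mulf_eq0 negb_or expf_neq0 //= unitmxE unitfE.
  (* (P / D)^-1 = D adj(P) / det(P), expanded by D so that the new denominator
     is a multiple of the old one. *)
  exists (D * \det P), (D%:M * D%:M * \adj P); split=> [|K' t'|B T w'].
  + rewrite rmorphM mulf_neq0 // (det_neq0 _ _ v) //.
    by have /mulmx1_unit[] := vK.
  + rewrite rmorphM mulf_eq0 negb_or => /andP[t'D t'P].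
    have [w wP] := ex _ _ t'D; exists (invmx w); apply: (RvInv wP).
      by rewrite -mulmxE mulmxV // -(det_neq0 _ _ _ t'D wP).
    by rewrite -mulmxE mulVmx // -(det_neq0 _ _ _ t'D wP).
  + move=> w'P; inversion w'P; subst.
    rewrite scalar_mxM -mul_adj_mx mulmxE !(rmorphM T) -(val _ _ _ H0).
    rewrite -!mulrA H1 mulr1.
    by congr (_ * _); rewrite -!(rmorphM T) scalar_mx_comm.
Qed.

Lemma map_scalar_mulE (K : comNzRingType) (theta : {rmorphism poly -> K}) D
    (v : 'M[K]_N) : map_mx theta D%:M * v = theta D *: v.
Proof. by rewrite map_scalar_mx -mulmxE mul_scalar_mx. Qed.

End ClearDenominators.

(** * Generic values over an infinite field *)

Lemma mpoly_rmorph_ext (R : comNzRingType) n (S : comNzRingType)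
    (f1 f2 : {rmorphism {mpoly R[n]} -> S}) :
  (forall c, f1 c%:MP = f2 c%:MP) -> (forall i, f1 'X_i = f2 'X_i) ->
  f1 =1 f2.
Proof.
move=> eqC eqX; elim/mpolyind => [|c m P _ _ IH]; first by rewrite !rmorph0.
rewrite !rmorphD IH -mul_mpolyC !rmorphM /= eqC; congr (_ * _ + _).
rewrite mpolyXE_id !rmorph_prod; apply: eq_bigr => i _.
by rewrite !rmorphXn /= eqX.
Qed.

Section InfiniteField.
Variable F : fieldType.
Hypothesis charF0 : [pchar F] =i pred0.

Lemma poly_natr_nonroot (R : idomainType) (f : {rmorphism F -> R})
    (P : {poly R}) : P != 0 -> exists a, P.[f a] != 0.
Proof.
move=> P0; apply: contrapT => noroot.
pose rs := [seq f i%:R | i <- iota 0 (size P)].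
have rs_roots : all (root P) rs.
  apply/allP => _ /mapP[i _ ->]; apply/rootP/eqP/negPn/negP => Pi.
  by apply: noroot; exists i%:R.
have rs_uniq : uniq rs.
  rewrite map_inj_uniq ?iota_uniq // => i j /fmorph_inj/eqP.
  wlog le_ij : i j / (i <= j)%N => [IH|].
    case/orP: (leq_total i j) => /IH// + H; rewrite eq_sym => /(_ H) ->//.
  rewrite eq_sym -subr_eq0 -natrB // ((pcharf0P F).1 charF0).
  by rewrite subn_eq0 => le_ji; apply/eqP; rewrite eqn_leq le_ij.
by have := max_poly_roots P0 rs_roots rs_uniq; rewrite size_map size_iota ltnn.
Qed.

(** The variables are specialized one after the other, each time avoiding the
    finitely many roots of a nonzero polynomial in the current variable. *)
Lemma mpoly_nonroot n (P : {mpoly F[n]}) : P != 0 -> exists v, P.@[v] != 0.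
Proof.
move=> P0.
suff [h hC Ph] : exists2 h : 'I_n -> {mpoly F[n]},
    forall i, i \in enum 'I_n -> exists a, h i = a%:MP
  & mmap (@mpolyC n F) h P != 0.
  have {}hC i : exists a, h i = a%:MP by apply: hC; rewrite mem_enum.
  exists (fun i => (h i)@_0); apply: contraNneq Ph => Pv.
  rewrite -[X in _ == X](mpolyC0 n F) -Pv; apply/eqP.
  pose f := (@mpolyC n F \o meval (fun i => (h i)@_0) : {rmorphism _ -> _}).
  apply: (mpoly_rmorph_ext (f1 := mmap (@mpolyC n F) h) (f2 := f)) => [c|i] /=.
    by rewrite mmapC mevalC.
  by rewrite mmapX mmap1U mevalXU; have [a ->] := hC i; rewrite mcoeffC eqxx mulr1.
elim: (enum 'I_n) => [|i r [h hC Ph]].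
  exists (fun i => 'X_i) => //; apply: contraNneq P0 => <-.
  apply/eqP/esym; apply: (mpoly_rmorph_ext (f1 := mmap (@mpolyC n F) (fun i => 'X_i))
    (f2 := idfun)) => [c|i] /=; first by rewrite mmapC.
  by rewrite mmapX mmap1U.
pose Q := mmap (polyC \o @mpolyC n F) (fun j => if j == i then 'X else (h j)%:P) P.
have Qev x : Q.[x] = mmap (@mpolyC n F) (fun j => if j == i then x else h j) P.
  apply: (mpoly_rmorph_ext (f1 := horner_eval x \o
    mmap (polyC \o @mpolyC n F) (fun j => if j == i then 'X else (h j)%:P))
   (f2 := mmap (@mpolyC n F) (fun j => if j == i then x else h j)))
    => [c|j] /=; first by rewrite !mmapC /= /horner_eval hornerC.
  rewrite !mmapX !mmap1U /horner_eval; case: eqP => _; by rewrite ?hornerX ?hornerC.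
have Q0 : Q != 0.
  apply: contraNneq Ph => Q0; have := Qev (h i); rewrite Q0 horner0 => /esym/eqP.
  have -> : (fun j => if j == i then h i else h j) = h.
    by apply/funext => j; case: eqP => [->|].
  by move=> ->.
have [a] := @poly_natr_nonroot _ (@mpolyC n F) _ Q0; rewrite Qev => Pa.
exists (fun j => if j == i then a%:MP else h j) => // j; rewrite inE.
by case: eqP => [_ _|_ /hC//]; exists a.
Qed.

End InfiniteField.

Section GenericValues.
Variables (F : fieldType) (g N : nat).
Local Notation poly := (tpoly F g N).
Implicit Types (r : rexpr F g) (a : 'I_g -> 'M[F]_N).

Definition eval_at a : {rmorphism poly -> F} := meval (tpoint a).

Lemma map_var_mx (S : comNzRingType) (f : {rmorphism poly -> S})
    (b : 'I_g -> 'M[S]_N) :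
  (forall k i j, f 'X_(enum_rank ((k, i, j) : tindex g N)) = b k i j) ->
  forall k, map_mx f (var_mx F N k) = b k.
Proof. by move=> fX k; apply/matrixP => i j; rewrite !mxE fX. Qed.

Lemma eval_var_mx a k : map_mx (eval_at a) (var_mx F N k) = a k.
Proof.
apply: map_var_mx => {}k i j.
by rewrite /eval_at /= mevalXU /tpoint enum_rankK.
Qed.

Lemma generic_valueP r (R : 'M[tfrac F g N]_N) :
  generic_value r R <-> pvalue (map_mx (@tofrac poly)) r R.
Proof.
apply: pvalue_map => // k; apply/matrixP => i j; by rewrite !mxE.
Qed.

Lemma mxvalueP a r v : mxvalue a r v <-> pvalue (map_mx (eval_at a)) r v.
Proof.
apply: pvalue_map => [c|k]; last by rewrite eval_var_mx.
by rewrite /= mevalC.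
Qed.

(** Both generic values have the form P / D.  They agree at all points where
    neither denominator vanishes, and these are dense. *)
Lemma generic_value_equiv (charF0 : [pchar F] =i pred0) (N_gt0 : (0 < N)%N)
    r1 r2 (R1 R2 : 'M[tfrac F g N]_N) :
  requiv r1 r2 -> generic_value r1 R1 -> generic_value r2 R2 -> R1 = R2.
Proof.
move=> eq_r /generic_valueP R1P /generic_valueP R2P.
have [D1 [P1 [D1n ex1 val1]]] := clear_denominators R1P.
have [D2 [P2 [D2n ex2 val2]]] := clear_denominators R2P.
rewrite tofrac_eq0 in D1n; rewrite tofrac_eq0 in D2n.
have {val1 val2} [/= v1 v2] := (fun B T => val1 B T, fun B T => val2 B T).
have E1 := v1 _ _ _ R1P; rewrite map_scalar_mulE in E1.
have E2 := v2 _ _ _ R2P; rewrite map_scalar_mulE in E2.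
have PE : D2 *: P1 = D1 *: P2.
  apply/eqP; rewrite -subr_eq0; apply/negPn/negP => /matrix0Pn[i [j]].
  set x := _ i j => x0.
  have [v] := mpoly_nonroot charF0 (mulf_neq0 (mulf_neq0 D1n D2n) x0).
  pose a k : 'M[F]_N := \matrix_(i, j) v (enum_rank ((k, i, j) : tindex g N)).
  have -> : (D1 * D2 * x).@[v] = eval_at a (D1 * D2 * x).
    apply: meval_eq => l; rewrite /tpoint; case El: (enum_val l) => [[k i'] j'].
    by rewrite mxE -El enum_valK.
  rewrite !rmorphM /= !mulf_eq0 !negb_or => /andP[/andP[d1 d2]].
  have [w1 w1P] := ex1 _ (eval_at a) d1; have [w2 w2P] := ex2 _ (eval_at a) d2.
  have w12 : w1 = w2.
    by apply: (eq_r N N_gt0 a); apply/mxvalueP.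
  have /matrixP/(_ i j) := v1 _ _ _ w1P; have /matrixP/(_ i j) := v2 _ _ _ w2P.
  rewrite !map_scalar_mulE /x -w12 !mxE rmorphB !rmorphM /=.
  by move=> <- <-; rewrite mulrCA subrr eqxx.
have /(congr1 (map_mx (@tofrac poly))) := PE.
rewrite !map_mxZ /= -E1 -E2 !scalerA.
rewrite mulrC => /(scalerI _) -> //.
by rewrite mulf_neq0 // tofrac_eq0.
Qed.

End GenericValues.

(** * Tensor products of matrices *)

Section Tensor.
Variable R : comNzRingType.

Lemma tensmxDl a b c d (A A' : 'M[R]_(a, b)) (B : 'M[R]_(c, d)) :
  (A + A') *t B = A *t B + A' *t B.
Proof. by apply/matrixP => i j; rewrite !mxE mulrDl. Qed.

Lemma tensmxDr a b c d (A : 'M[R]_(a, b)) (B B' : 'M[R]_(c, d)) :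
  A *t (B + B') = A *t B + A *t B'.
Proof. by apply/matrixP => i j; rewrite !mxE mulrDr. Qed.

Lemma tensmxZl a b c d x (A : 'M[R]_(a, b)) (B : 'M[R]_(c, d)) :
  (x *: A) *t B = x *: (A *t B).
Proof. by apply/matrixP => i j; rewrite !mxE mulrA. Qed.

Lemma tensmxZr a b c d x (A : 'M[R]_(a, b)) (B : 'M[R]_(c, d)) :
  A *t (x *: B) = x *: (A *t B).
Proof. by apply/matrixP => i j; rewrite !mxE mulrCA. Qed.

Lemma tensmx_sumr I (r : seq I) (P : pred I) a b c d
    (A : 'M[R]_(a, b)) (B : I -> 'M[R]_(c, d)) :
  A *t (\sum_(i <- r | P i) B i) = \sum_(i <- r | P i) A *t B i.
Proof.
elim/big_rec2: _ => [|i A1 A2 _ <-]; first exact: tensmx0.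
exact: tensmxDr.
Qed.

Lemma tensmx_scalar (a b : nat) (x y : R) :
  (x%:M : 'M_a) *t (y%:M : 'M_b) = (x * y)%:M.
Proof.
apply/matrixP => i j; case: (mxtens_indexP i) => i1 i2.
case: (mxtens_indexP j) => j1 j2; rewrite tensmxE !mxE.
rewrite (can_eq (@mxtens_indexK a b)) xpair_eqE.
by case: (i1 == j1); case: (i2 == j2); rewrite ?mulr0 ?mul0r.
Qed.

Lemma tensmx11 a b : (1%:M : 'M[R]_a) *t (1%:M : 'M_b) = 1%:M.
Proof. by rewrite tensmx_scalar mulr1. Qed.

Variables (s m : nat).

(** The entry in position (u, v) of M, seen as an m x m matrix with entries in
    the s x s matrices. *)
Definition tblock (M : 'M[R]_(s * m)) (u v : 'I_m) : 'M[R]_s :=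
  \matrix_(a, b) M (mxtens_index (a, u)) (mxtens_index (b, v)).

Lemma tblock_sum M : M = \sum_u \sum_v tblock M u v *t delta_mx u v.
Proof.
apply/matrixP => i j; case: (mxtens_indexP i) => a u.
case: (mxtens_indexP j) => b v; rewrite summxE (bigD1 u) //= summxE (bigD1 v) //=.
rewrite !big1 ?addr0.
- by rewrite tensmxE !mxE !eqxx mulr1.
- move=> u' Nu; rewrite summxE big1 // => v' _.
  by rewrite tensmxE !mxE eq_sym (negPf Nu) mulr0.
- by move=> v' Nv; rewrite tensmxE !mxE [v == _]eq_sym (negPf Nv) andbF mulr0.
Qed.

Lemma tblock_tens (A : 'M_s) (B : 'M_m) u v : tblock (A *t B) u v = B u v *: A.
Proof. by apply/matrixP => a b; rewrite !mxE !mxtens_indexK mulrC. Qed.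

Lemma tblockB M M' u v : tblock (M - M') u v = tblock M u v - tblock M' u v.
Proof. by apply/matrixP => a b; rewrite !mxE. Qed.

End Tensor.

Lemma tblock_sumK (R : comNzRingType) s m (Y : 'I_m -> 'I_m -> 'M[R]_s) u w :
  tblock (\sum_i \sum_j Y i j *t delta_mx i j) u w = Y u w.
Proof.
apply/matrixP => x y; rewrite mxE summxE (bigD1 u) //= summxE (bigD1 w) //=.
rewrite !big1 ?addr0.
- by rewrite tensmxE !mxE !eqxx mulr1.
- move=> u' Nu; rewrite summxE big1 // => w' _.
  by rewrite tensmxE !mxE eq_sym (negPf Nu) mulr0.
- by move=> w' Nw; rewrite tensmxE !mxE [w == _]eq_sym (negPf Nw) andbF mulr0.
Qed.

Lemma cast_mxtens_index k s d (e : (k * (s * d) = k * s * d)%N)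
    (x : 'I_k) (y : 'I_s) (z : 'I_d) :
  cast_ord (esym e) (mxtens_index (mxtens_index (x, y), z)) =
  mxtens_index (x, mxtens_index (y, z)).
Proof. by apply: val_inj; rewrite /= mulnDl mulnA addnA. Qed.

Lemma tensmxA (R : comNzRingType) k s d (A : 'M[R]_k) (B : 'M[R]_s) (C : 'M[R]_d)
    (e : (k * (s * d) = k * s * d)%N) :
  castmx (e, e) (A *t (B *t C)) = A *t B *t C.
Proof.
apply/matrixP => i j; rewrite castmxE.
case: (mxtens_indexP i) => i1 i3; case: (mxtens_indexP i1) => {i1} i1 i2.
case: (mxtens_indexP j) => j1 j3; case: (mxtens_indexP j1) => {j1} j1 j2.
by rewrite !cast_mxtens_index !tensmxE mulrA.
Qed.

Lemma tensmxBr (R : comNzRingType) a b e f (A : 'M[R]_(a, b)) (B B' : 'M[R]_(e, f)) :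
  A *t (B - B') = A *t B - A *t B'.
Proof. by rewrite tensmxDr -scaleN1r tensmxZr scaleN1r. Qed.

Lemma unitmx_cast (R : comUnitRingType) a b (e : a = b) (M : 'M[R]_a) :
  (castmx (e, e) M \in unitmx) = (M \in unitmx).
Proof. by case: _ / e; rewrite castmx_id. Qed.

Lemma sum_mxtens (V : nmodType) s d (f : 'I_(s * d) -> V) :
  \sum_i f i = \sum_a \sum_i f (mxtens_index (a, i)).
Proof.
rewrite (reindex (@mxtens_index s d)) /=; last first.
  by exists (@mxtens_unindex s d) => ? _; rewrite (mxtens_indexK, mxtens_unindexK).
by rewrite pair_bigA; apply: eq_bigr => -[a i].
Qed.

Section TensorBlocks.
Variable R : comNzRingType.

Lemma block_mx_sum a b (A : 'M[R]_a) B C (D : 'M_b) :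
  let e1 := col_mx 1%:M 0 : 'M_(a + b, a) in
  let e2 := col_mx 0 1%:M : 'M_(a + b, b) in
  block_mx A B C D = e1 *m A *m e1^T + e1 *m B *m e2^T
    + e2 *m C *m e1^T + e2 *m D *m e2^T.
Proof.
rewrite /= !tr_col_mx !trmx1 !trmx0 !mul_col_mx !mul1mx !mul0mx !mul_mx_row.
rewrite !mulmx1 !mulmx0 block_mxEv !add_col_mx !(addr0, add0r) !add_row_mx.
by rewrite !(addr0, add0r).
Qed.

(** The two sides have convertible sizes, which makes a recursion on the number
    of diagonal blocks possible without casts. *)
Lemma tens1_block k s (y : 'M[R]_s) :
  (1%:M : 'M_k.+1) *t y = block_mx y 0 0 ((1%:M : 'M_k) *t y) :> 'M_(s + k * s).
Proof.
have idx0 (i : 'I_s) : lshift (k * s) i = mxtens_index (ord0 : 'I_k.+1, i).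
  exact: val_inj.
have idxS (a : 'I_k) (i : 'I_s) : rshift s (mxtens_index (a, i)) =
    mxtens_index (lift ord0 a : 'I_k.+1, i).
  by apply: val_inj; rewrite /= /bump /= mulSn addnA.
pose E := tensmxE (1%:M : 'M_k.+1) y.
apply/matrixP => i j; rewrite -[i]splitK -[j]splitK.
case: (split i) => i' /=; case: (split j) => j' /=.
- by rewrite block_mxEul !idx0 [LHS]E mxE eqxx mul1r.
- rewrite block_mxEur; case: (mxtens_indexP j') => a' j''.
  by rewrite idx0 idxS [LHS]E !mxE mul0r.
- rewrite block_mxEdl; case: (mxtens_indexP i') => a' i''.
  by rewrite idx0 idxS [LHS]E !mxE mul0r.
- rewrite block_mxEdr; case: (mxtens_indexP i') => a' i''.
  case: (mxtens_indexP j') => b' j''; rewrite !idxS [LHS]E [RHS]tensmxE !mxE.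
  by rewrite (inj_eq lift_inj).
Qed.

End TensorBlocks.

(** * Order of vanishing of polynomial matrices *)

(** Divisibility by the e-th power of the variable, in terms of coefficients. *)
Definition vanishes (R : comNzRingType) e a b (Z : 'M[{poly R}]_(a, b)) :=
  forall i j k, (k < e)%N -> (Z i j)`_k = 0.

Section Vanishing.
Variable R : comNzRingType.

Lemma coef_mul_low e (q x : {poly R}) k : (k < e)%N ->
  (forall k, (k < e)%N -> x`_k = 0) -> (q * x)`_k = 0.
Proof.
move=> ke x0; rewrite coefM big1 // => l _.
by rewrite x0 ?mulr0 // (leq_ltn_trans _ ke) ?leq_subr.
Qed.

Lemma vanishes_mull e a b c (U : 'M_(a, b)) (Z : 'M[{poly R}]_(b, c)) :
  vanishes e Z -> vanishes e (U *m Z).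
Proof.
move=> Z0 i j k ke; rewrite mxE coef_sum big1 // => l _.
by apply: coef_mul_low (ke) _ => k' k'e; apply: Z0.
Qed.

Lemma vanishes_scale e a b q (Z : 'M[{poly R}]_(a, b)) :
  vanishes e Z -> vanishes e (q *: Z).
Proof. by rewrite -mul_scalar_mx; apply: vanishes_mull. Qed.

Lemma vanishes_mulr e a b c (U : 'M_(b, c)) (Z : 'M[{poly R}]_(a, b)) :
  vanishes e Z -> vanishes e (Z *m U).
Proof.
move=> Z0 i j k ke; rewrite mxE coef_sum big1 // => l _.
by rewrite mulrC; apply: coef_mul_low (ke) _ => k' k'e; apply: Z0.
Qed.

Lemma vanishes_div e a b (Z : 'M[{poly R}]_(a, b)) :
  vanishes e Z -> exists Z', Z = 'X^e *: Z'.
Proof.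
move=> Z0; exists (map_mx (drop_poly e) Z); apply/matrixP => i j.
rewrite !mxE -[LHS](poly_take_drop e) [take_poly _ _](_ : _ = 0) ?add0r.
  by rewrite mulrC.
apply/polyP => k; rewrite coef_take_poly coef0.
by case: ltnP => // ke; apply: Z0.
Qed.

End Vanishing.

(** A polynomial with nonzero constant term is prime to the variable. *)
Lemma coef_div_low (R : idomainType) e (q x : {poly R}) :
  q`_0 != 0 -> (forall k, (k < e)%N -> (q * x)`_k = 0) ->
  forall k, (k < e)%N -> x`_k = 0.
Proof.
move=> q0 qx0; elim/ltn_ind => k IHk ke; have /eqP := qx0 k ke.
rewrite coefM big_ord_recl subn0 big1 => [|l _]; last first.
  rewrite IHk ?mulr0 //= /bump /= add1n ?(leq_ltn_trans _ ke) ?leq_subr //.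
  by rewrite ltn_subrL /= (leq_ltn_trans _ (ltn_ord l)).
by rewrite addr0 mulf_eq0 (negPf q0) => /eqP.
Qed.

(** * Evaluation of series *)

Section PowerSeries.
Variables (K : fieldType) (N : nat).

(** A series whose coefficient at a word depends on the length of the word only
    is a power series in one variable, and the product of such series is the
    product of power series: any alphabet can be used for this purpose, here a
    single variable. *)
Definition poly_series (M : 'M[{poly K}]_N) : gseries K 1 N :=
  GSeries (fun w => map_mx (coefp (size w)) M).

Fact poly_series_zmod : zmod_morphism poly_series.
Proof.
by move=> M M'; apply: gseriesP => w; apply/matrixP => i j; rewrite !mxE /= coefB.
Qed.

Fact poly_series_monoid : monoid_morphism poly_series.
Proof.
split=> [|M M']; apply: gseriesP => w.
  apply/matrixP => i j; case: w => [|l w]; rewrite !mxE /= coefMn coef1 ?mul0rn //.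
apply/matrixP => i j; rewrite /= summxE !mxE coef_sum.
under eq_bigr do rewrite coefM.
rewrite exchange_big /=; apply: eq_bigr => d _; rewrite !mxE.
apply: eq_bigr => k _.
have le_d : (d <= size w)%N by rewrite -ltnS.
by rewrite !mxE [size (take _ _)]size_takel // [size (drop _ _)]size_drop.
Qed.

HB.instance Definition _ := GRing.isZmodMorphism.Build _ _ poly_series
  poly_series_zmod.
HB.instance Definition _ := GRing.isMonoidMorphism.Build _ _ poly_series
  poly_series_monoid.

End PowerSeries.

Lemma sum_triple (V : nmodType) (I J L : finType) (f : I * J * L -> V) :
  \sum_l f l = \sum_u \sum_k \sum_v f (u, k, v).
Proof.
rewrite pair_bigA pair_bigA /=.
by apply: eq_bigr => -[[u k] v].
Qed.

Lemma gcoef_constM (F : fieldType) g m (a : 'M[F]_m) (T : gseries F g m) w :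
  gcoef (gconst a * T) w = a *m gcoef T w.
Proof.
rewrite /= big_ord_recl take0 drop0 big1 ?addr0 // => d _.
by case: w d => [|l t] d /=; [case: d | rewrite mul0mx].
Qed.

Section Evaluation.
Variables (F K : fieldType) (g m s : nat) (emb : {rmorphism F -> K}).
Local Notation letter := ('I_m * 'I_g * 'I_m)%type.
Variable y : letter -> 'M[K]_s.
Implicit Types S T : gseries F g m.

Definition gtail S (l : gletter g m) := GSeries (fun w => gcoef S (l :: w)).

(** The part of degree n of the evaluation of S, where y (x) 1 is substituted for
    the letters: the sum of y_w (x) S_w over the words w of length n. *)
Fixpoint hpart n S : 'M[K]_(s * m) :=
  if n is n'.+1 then \sum_(l : letter) (y l *t 1%:M) *m hpart n' (gtail S l)
  else 1%:M *t map_mx emb (gcoef S [::]).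

Lemma hpart_ext n S T :
  (forall w, size w = n -> gcoef S w = gcoef T w) -> hpart n S = hpart n T.
Proof.
elim: n S T => [|n IHn] S T eqST /=; first by rewrite eqST.
apply: eq_bigr => l _; congr (_ *m _); apply: IHn => w sw /=.
by rewrite eqST //= sw.
Qed.

Lemma hpartD n S T : hpart n (S + T) = hpart n S + hpart n T.
Proof.
elim: n S T => [|n IHn] S T /=; first by rewrite map_mxD tensmxDr.
rewrite -big_split; apply: eq_bigr => l _ /=; rewrite -mulmxDr -IHn.
by congr (_ *m hpart n _); apply: gseriesP.
Qed.

Lemma hpartN n S : hpart n (- S) = - hpart n S.
Proof.
elim: n S => [|n IHn] S /=.
  by rewrite map_mxN -scaleN1r tensmxZr scaleN1r.
rewrite -sumrN; apply: eq_bigr => l _ /=; rewrite -mulmxN -IHn.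
by congr (_ *m hpart n _); apply: gseriesP.
Qed.

Lemma hpart_constM n a S :
  hpart n (gconst a * S) = (1%:M *t map_mx emb a) *m hpart n S.
Proof.
elim: n S => [|n IHn] S.
  by rewrite /hpart gcoef_constM map_mxM -[1%:M]mulmx1 -tensmx_mul mulmx1.
rewrite [LHS]/= mulmx_sumr; apply: eq_bigr => l _ /=.
rewrite mulmxA tensmx_mul mul1mx mulmx1 -[y l in RHS]mulmx1 -[map_mx _ _]mul1mx.
rewrite -tensmx_mul -mulmxA -IHn; congr (_ *m _); apply: hpart_ext => w _.
by rewrite gcoef_constM [LHS]gcoef_constM.
Qed.

Lemma hpartM n S T :
  hpart n (S * T) = \sum_(d < n.+1) hpart d S *m hpart (n - d) T.
Proof.
elim: n S => [|n IHn] S.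
  rewrite big_ord1 subnn /hpart [gcoef _ _]gmul_nil map_mxM.
  by rewrite -[1%:M]mulmx1 -tensmx_mul mulmx1.
rewrite big_ord_recl subn0 -[_ *m _](hpart_constM n.+1) [in LHS]/=.
rewrite [hpart n.+1 _]/=.
under [X in _ = _ + X]eq_bigr => d _ do rewrite mulmx_suml.
rewrite exchange_big -big_split; apply: eq_bigr => l _ /=.
under [X in _ = _ + X]eq_bigr => d _ do rewrite -mulmxA subSS.
rewrite -mulmx_sumr -IHn -mulmxDr -hpartD; congr (_ *m _).
apply: hpart_ext => w _; rewrite [LHS]gmul_cons [in RHS]/=.
congr (_ + _); rewrite [RHS]big_ord_recl take0 drop0 big1 ?addr0 // => d _.
by rewrite /= mul0mx.
Qed.

(** Collecting the homogeneous parts turns the evaluation, which need not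
    converge, into a morphism to power series. *)
Definition gseval S : gseries K 1 (s * m) := GSeries (fun w => hpart (size w) S).

Fact gseval_zmod : zmod_morphism gseval.
Proof. by move=> S T; apply: gseriesP => w /=; rewrite hpartD hpartN. Qed.

Lemma hpart_const n a :
  hpart n (gconst a) = if n is 0 then 1%:M *t map_mx emb a else 0.
Proof.
case: n => [|n] //; rewrite -[gconst a]mulr1 hpart_constM.
have -> : hpart n.+1 1 = 0; last by rewrite mulmx0.
rewrite /= big1 // => l _; have -> : gtail 1 l = 0 by apply: gseriesP.
have -> : hpart n 0 = 0; last by rewrite mulmx0.
by apply: (addrI (hpart n 0)); rewrite -hpartD !addr0.
Qed.

Fact gseval_monoid : monoid_morphism gseval.
Proof.
split=> [|S T]; apply: gseriesP => w /=; last first.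
  rewrite hpartM; apply: eq_bigr => d _.
  have le_d : (d <= size w)%N by rewrite -ltnS.
  by rewrite [size (take _ _)]size_takel // [size (drop _ _)]size_drop.
rewrite hpart_const; case: w => //=.
by rewrite map_scalar_mx rmorph1 tensmx11.
Qed.

HB.instance Definition _ := GRing.isZmodMorphism.Build _ _ gseval gseval_zmod.
HB.instance Definition _ := GRing.isMonoidMorphism.Build _ _ gseval gseval_monoid.

Lemma hpart_var n k : hpart n (gvar k) =
  if n is 1 then \sum_u \sum_v y (u, k, v) *t delta_mx u v else 0.
Proof.
have h0 j : hpart j 0 = 0.
  by apply: (addrI (hpart j 0)); rewrite -hpartD !addr0.
case: n => [|n]; first by rewrite /= map_mx0 tensmx0.
rewrite /= sum_triple.
have tE u k' v : gtail (gvar k) (u, k', v) =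
    if k' == k then gconst (delta_mx u v) else 0 :> gseries F g m.
  by apply: gseriesP => w /=; case: w => [|? ?]; case: eqP.
transitivity (\sum_u \sum_v (y (u, k, v) *t 1%:M) *m hpart n (gconst (delta_mx u v))).
  apply: eq_bigr => u _; rewrite (bigD1 k) //= [X in _ + X]big1 ?addr0 => [|k' Nk].
    by apply: eq_bigr => v _; rewrite tE eqxx.
  by apply: big1 => v _; rewrite tE (negPf Nk) h0 mulmx0.
case: n => [|n]; last first.
  by rewrite big1 // => u _; rewrite big1 // => v _; rewrite hpart_const mulmx0.
apply: eq_bigr => u _; apply: eq_bigr => v _.
by rewrite hpart_const map_delta_mx tensmx_mul mulmx1 mul1mx.
Qed.

Variables (d : nat) (X : letter -> 'M[F]_d).

Fixpoint xword (w : seq letter) : 'M[F]_d :=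
  if w is l :: w' then X l *m xword w' else 1%:M.

(** The sum of y_w (x) X_w over the words w of length n is the n-th power of the
    sum of y_l (x) X_l over the letters. *)
Lemma hpart_rational (c : 'M_(m, d)) (b : 'M_(d, m)) S n :
  (forall w, gcoef S w = c *m xword w *m b) ->
  hpart n S = (1%:M *t map_mx emb c) *m
    (\sum_l y l *t map_mx emb (X l)) ^+ n *m (1%:M *t map_mx emb b).
Proof.
elim: n S c => [|n IHn] S c SE.
  by rewrite /= SE /= mulmx1 expr0 mulmx1 tensmx_mul mulmx1 map_mxM.
rewrite [LHS]/= exprS -mulmxE !mulmxA mulmx_sumr !mulmx_suml; apply: eq_bigr => l _.
rewrite (IHn _ (c *m X l)) => [|w]; last by rewrite /= SE /= !mulmxA.
by rewrite !mulmxA !tensmx_mul !(mul1mx, mulmx1) map_mxM.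
Qed.

End Evaluation.

(** * The generic value as a realization *)

Section RationalSeries.
Variables (K : fieldType) (N e : nat).
Variables (C : 'M[K]_(N, e)) (Y : 'M[K]_e) (B : 'M[K]_(e, N)).

(** The hypothesis says P = D C (1 - h Y)^-1 B as power series in h.  The partial
    sums of the geometric series give the identity modulo every power of h,
    after multiplication by det(1 - h Y). *)
Lemma rational_of_series (D : {poly K}) (P : 'M[{poly K}]_N) :
  (forall n, map_mx (coefp n) P = \sum_(d < n.+1) D`_d *: (C *m Y ^+ (n - d) *m B)) ->
  let L := 1%:M - 'X *: map_mx polyC Y in
  \det L *: P = D *: (map_mx polyC C *m \adj L *m map_mx polyC B).
Proof.
move=> PE L; apply/matrixP => i j; apply/polyP => n.
pose G M : 'M[{poly K}]_e := \sum_(k < M) 'X^k *: map_mx polyC (Y ^+ k).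
have LG M : L *m G M = 1%:M - 'X^M *: map_mx polyC (Y ^+ M).
  elim: M => [|M IHM]; first by rewrite /G big_ord0 mulmx0 expr0 expr0 scale1r map_scalar_mx rmorph1 subrr.
  rewrite {1}/G big_ord_recr /= mulmxDr IHM /L mulmxBl mul1mx -scalemxAr.
  rewrite -scalemxAl scalerA -map_mxM mulmxE -exprS -exprSr.
  by rewrite addrA addrNK.
(* CG is kept abstract, so that mxE does not unfold it. *)
have [CG CGdef] : {CG | CG = map_mx polyC C *m G n.+1 *m map_mx polyC B}.
  by eexists.
have CGE k i' j' : (k <= n)%N -> (CG i' j')`_k = (C *m Y ^+ k *m B) i' j'.
  move=> kn; rewrite CGdef /G mulmx_sumr mulmx_suml summxE coef_sum.
  rewrite (bigD1 (Ordinal (kn : (k < n.+1)%N))) //= -scalemxAr -scalemxAl -!map_mxM.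
  rewrite !mxE coefXnM ltnn subnn coefC /= [X in _ + X]big1 ?addr0 // => k' Nk.
  rewrite -scalemxAr -scalemxAl -!map_mxM !mxE coefXnM coefC.
  case: ltnP => // le_k; rewrite subn_eq0 leqNgt ltn_neqAle le_k andbT.
  by rewrite -val_eqE /= in Nk; rewrite Nk.
have lowP : vanishes n.+1 (P - D *: CG).
  move=> i' j' k kn; have /matrixP/(_ i' j') := PE k.
  rewrite summxE !mxE coefB => /= ->; apply/eqP; rewrite subr_eq0; apply/eqP.
  rewrite coefM; apply: eq_bigr => d _; rewrite CGE ?mxE //.
  by rewrite (leq_trans (leq_subr _ _)).
have lowG : vanishes n.+1 (D *: (map_mx polyC C *m (\det L *: G n.+1 - \adj L) *m map_mx polyC B)).
  apply: vanishes_scale; have -> : \det L *: G n.+1 - \adj L =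
      'X^(n.+1) *: (- (\adj L *m map_mx polyC (Y ^+ n.+1))).
    rewrite -mul_scalar_mx -mul_adj_mx -mulmxA LG mulmxBr mulmx1 -scalemxAr.
    by rewrite addrC addKr scalerN.
  rewrite -scalemxAr -scalemxAl => i' j' k kn.
  by rewrite mxE coefXnM kn.
have -> : \det L *: P = D *: (map_mx polyC C *m \adj L *m map_mx polyC B) +
    (\det L *: (P - D *: CG) + D *: (map_mx polyC C *m
      (\det L *: G n.+1 - \adj L) *m map_mx polyC B)).
  rewrite mulmxBr mulmxBl -scalemxAr -scalemxAl -CGdef !scalerBr !scalerA.
  by rewrite [D * _]mulrC [X in _ + X]addrA addrNK addrCA subrr addr0.
rewrite mxE coefD [X in _ + X](_ : _ = 0) ?addr0 //.
by rewrite mxE coefD (vanishes_scale _ lowP) // lowG // addr0.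
Qed.

End RationalSeries.

Section Pencil.
Variables (F : fieldType) (g m : nat).
Local Notation letter := ('I_m * 'I_g * 'I_m)%type.

(** The blocks of T - iota(p), indexed by letters: these are the values of the
    letters when T is substituted for the variables. *)
Definition local_coord (E : comNzRingType) (emb : {rmorphism F -> E}) s
    (p : 'I_g -> 'M[F]_m) (T : 'I_g -> 'M[E]_(s * m)) (l : letter) : 'M[E]_s :=
  tblock (T l.1.2) l.1.1 l.2 - (emb (p l.1.2 l.1.1 l.2))%:M.

Definition pencil (E : comNzRingType) (emb : {rmorphism F -> E}) s d
    (X : letter -> 'M[F]_d) (y : letter -> 'M[E]_s) : 'M[E]_(s * d) :=
  1%:M - \sum_l y l *t map_mx emb (X l).

Lemma local_coordE (E : comNzRingType) (emb : {rmorphism F -> E}) s p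
    (T : 'I_g -> 'M[E]_(s * m)) u k v :
  local_coord emb p T (u, k, v) = tblock (T k - 1%:M *t map_mx emb (p k)) u v.
Proof. by rewrite tblockB tblock_tens mxE scalemx1. Qed.

Lemma local_coordK (E : comNzRingType) (emb : {rmorphism F -> E}) s p
    (T : 'I_g -> 'M[E]_(s * m)) k :
  \sum_u \sum_v local_coord emb p T (u, k, v) *t delta_mx u v =
  T k - 1%:M *t map_mx emb (p k).
Proof.
rewrite [RHS]tblock_sum; apply: eq_bigr => u _; apply: eq_bigr => v _.
by rewrite local_coordE.
Qed.

Lemma map_local_coord (E E' : comNzRingType) (emb : {rmorphism F -> E})
    (emb' : {rmorphism F -> E'}) (f : {rmorphism E -> E'}) s p
    (T : 'I_g -> 'M[E]_(s * m)) l :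
  (forall c, f (emb c) = emb' c) ->
  map_mx f (local_coord emb p T l) =
  local_coord emb' p (fun k => map_mx f (T k)) l.
Proof.
move=> fE; rewrite map_mxB map_scalar_mx /= fE; congr (_ - _).
by apply/matrixP => i j; rewrite !mxE.
Qed.

Lemma map_mx_emb (E E' : comNzRingType) (emb : {rmorphism F -> E})
    (emb' : {rmorphism F -> E'}) (f : {rmorphism E -> E'}) a b (M : 'M[F]_(a, b)) :
  (forall c, f (emb c) = emb' c) -> map_mx f (map_mx emb M) = map_mx emb' M.
Proof. by move=> fE; apply/matrixP => i j; rewrite !mxE fE. Qed.

Lemma map_pencil (E E' : comNzRingType) (emb : {rmorphism F -> E})
    (emb' : {rmorphism F -> E'}) (f : {rmorphism E -> E'}) s d
    (X : letter -> 'M[F]_d) (y : letter -> 'M[E]_s) y' :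
  (forall c, f (emb c) = emb' c) -> (forall l, map_mx f (y l) = y' l) ->
  map_mx f (pencil emb X y) = pencil emb' X y'.
Proof.
move=> fE yE; rewrite map_mxB map_mx1 raddf_sum; congr (_ - _).
by apply: eq_bigr => l _; rewrite /= map_mxT yE (map_mx_emb _ fE).
Qed.

End Pencil.

Lemma horner_line1 (R : comNzRingType) (e f : R) :
  (e%:P + 'X * (f - e)%:P).[1] = f.
Proof. by rewrite hornerD hornerM hornerX !hornerC mul1r addrC subrK. Qed.

Section GenericFormula.
Variables (F : fieldType) (g m s d : nat).
Hypotheses (m_gt0 : (0 < m)%N) (s_gt0 : (0 < s)%N).
Local Notation letter := ('I_m * 'I_g * 'I_m)%type.
Local Notation N := (s * m)%N.
Local Notation poly := (tpoly F g N).
Variables (p : 'I_g -> 'M[F]_m) (c : 'M[F]_(m, d)) (b : 'M[F]_(d, m)).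
Variable (X : letter -> 'M[F]_d).

Let a0 k : 'M[F]_N := iota_mx s (p k).
Let gen_pt (k : 'I_g) := var_mx F N k : 'M[poly]_N.

Definition generic_pencil : 'M[poly]_(s * d) :=
  pencil (pconst g N) X (local_coord (pconst g N) p gen_pt).

Lemma iota_is_zmod : zmod_morphism (@iota_mx F m s).
Proof.
move=> x y; rewrite /iota_mx -scaleN1r tensmxDr tensmxZr.
by rewrite scaleN1r.
Qed.
Lemma iota_is_monoid : monoid_morphism (@iota_mx F m s).
Proof.
split=> [|x y]; rewrite /iota_mx ?tensmx11 //.
by rewrite -!mulmxE tensmx_mul mul1mx.
Qed.
HB.instance Definition _ := GRing.isZmodMorphism.Build _ _ (@iota_mx F m s) iota_is_zmod.
HB.instance Definition _ := GRing.isMonoidMorphism.Build _ _ (@iota_mx F m s) iota_is_monoid.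

Lemma mxvalue_iota r v : mxvalue p r v -> mxvalue a0 r (iota_mx s v).
Proof. by apply: rvalue_map => // k /=; rewrite /iota_mx tensmx_scalar mul1r. Qed.

(** Restrict to the line iota(p) + h (T - iota(p)) for generic T.  The expansion
    of r about p can be evaluated there as a power series in h, which gives both
    P / D, by [clear_denominators], and C (1 - h Y)^-1 B, by the realization.
    The resulting identity is one of polynomials in h, and h = 1 gives back T. *)
Lemma generic_formula r v S :
  mxvalue p r v -> expansion r p S -> (forall w, gcoef S w = c *m xword X w *m b) ->
  exists (D : poly) (P : 'M[poly]_N), [/\ D != 0,
    exists2 R, generic_value r R & tofrac D *: R = map_mx (@tofrac poly) P
  & \det generic_pencil *: P = D *: ((1%:M *t map_mx (pconst g N) c) *m
      \adj generic_pencil *m (1%:M *t map_mx (pconst g N) b))].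
Proof.
move=> /mxvalue_iota/mxvalueP rp; move=> expS SE.
have [D [P [Da ex val]]] := clear_denominators rp.
have D0 : D != 0 by apply: contraNneq Da => ->; rewrite rmorph0.
exists D, P; split=> //.
  have [|R RP] := ex _ (@tofrac poly); first by rewrite tofrac_eq0.
  exists R; first exact/generic_valueP.
  by have := val _ _ _ RP; rewrite map_scalar_mulE.
pose K := tfrac F g N.
pose frac := @tofrac poly : {rmorphism poly -> K}.
pose emb := frac \o pconst g N : {rmorphism F -> K}.
pose lift := polyC \o emb : {rmorphism F -> {poly K}}.
pose var_at (i : 'I_#|tindex g N|) : {poly K} := let: (k, u, v) := enum_val i in
  (emb (a0 k u v))%:P + 'X * (frac 'X_i - emb (a0 k u v))%:P.
(* theta restricts polynomials to the line; it sends T to iota(p) + h (T - iota(p)). *)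
pose theta := mmap lift var_at : {rmorphism poly -> {poly K}}.
have thetaC x : theta (pconst g N x) = lift x by rewrite /theta /= mmapC.
have thetaX k i j : theta 'X_(enum_rank ((k, i, j) : tindex g N)) =
    (emb (a0 k i j))%:P + 'X * (frac 'X_(enum_rank ((k, i, j) : tindex g N)) - emb (a0 k i j))%:P.
  by rewrite /theta /= mmapX mmap1U /var_at enum_rankK.
pose T := @poly_series K N \o map_mx theta : {rmorphism 'M[poly]_N -> gseries K 1 N}.
pose y := local_coord emb p (fun k => map_mx frac (gen_pt k)).
have TS : pvalue T r (gseval emb y S).
  apply: rvalue_map expS => [x|k].
    apply: gseriesP => w /=; rewrite hpart_const.
    rewrite map_scalar_mx /= thetaC /= !map_scalar_mx tensmx_scalar mul1r.
    by apply/matrixP => i j; case: w => [|? ?]; rewrite !mxE /= coefMn coefC /= ?mul0rn.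
  apply: gseriesP => w /=; rewrite hpartD hpart_var hpart_const local_coordK.
  apply/matrixP => i j.
  have -> : forall n, map_mx (coefp n) (map_mx theta (var_mx F N k)) i j =
    (theta 'X_(enum_rank ((k, i, j) : tindex g N)))`_n by move=> n; rewrite !mxE.
  rewrite thetaX coefD coefC coefXM coefC.
  have -> : 1%:M *t map_mx emb (p k) = map_mx emb (a0 k).
    by rewrite map_mxT map_mx1.
  by case: (size w) => [|[|n]]; rewrite !mxE ?(addr0, add0r).
have gen_p : 'I_N by exists 0%N; rewrite muln_gt0 s_gt0.
pose C : 'M[K]_(s * m, s * d) := 1%:M *t map_mx emb c; pose B : 'M[K]_(s * d, s * m) := 1%:M *t map_mx emb b.
pose Y : 'M[K]_(s * d) := \sum_l y l *t map_mx emb (X l).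
have coefP n : map_mx (coefp n) (map_mx theta P) =
    \sum_(k < n.+1) (theta D)`_k *: (C *m Y ^+ (n - k) *m B).
  have /(congr1 (fun G => gcoef G (nseq n (gen_p, ord0, gen_p)))) := val _ _ _ TS.
  rewrite /= size_nseq => <-; apply: eq_bigr => k _.
  have le_k : (k <= n)%N by rewrite -ltnS.
  rewrite size_drop size_nseq [size (take _ _)]size_takel ?size_nseq //.
  rewrite (hpart_rational _ _ _ SE) -/C -/B -/Y -mul_scalar_mx.
  by congr (_ *m _); apply/matrixP => i j; rewrite !mxE rmorphMn /= coefMn.
have := congr1 (map_mx (horner_eval 1)) (rational_of_series coefP).
have thetaK x : (theta x).[1] = frac x.
  apply: (mpoly_rmorph_ext (f1 := horner_eval 1 \o theta) (f2 := frac)) => [a|i].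
    by rewrite /= thetaC /horner_eval /= hornerC.
  rewrite /= /horner_eval -(enum_valK i); case: (enum_val i) => [[k u] v'].
  by rewrite thetaX horner_line1.
set L := 1%:M - _.
have LE : map_mx (horner_eval 1) L = map_mx frac generic_pencil.
  rewrite (map_pencil (emb' := emb) _ (y' := y)) // => [|l]; last first.
    exact: map_local_coord.
  rewrite /pencil -/Y; apply/matrixP => i j.
  by rewrite !mxE /horner_eval !hornerE /=; case: (i == j); rewrite ?hornerE.
have evC a e (M : 'M[K]_(a, e)) : map_mx (horner_eval 1) (map_mx polyC M) = M.
  by apply/matrixP => i j; rewrite !mxE /horner_eval hornerC.
have evtheta a e (M : 'M[poly]_(a, e)) :
    map_mx (horner_eval 1) (map_mx theta M) = map_mx frac M.
  by apply/matrixP => i j; rewrite !mxE /horner_eval thetaK.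
rewrite !map_mxZ -det_map_mx !map_mxM map_mx_adj LE !evC evtheta.
rewrite [X in _ = X *: _](thetaK D) det_map_mx -map_mx_adj => E.
have CE : C = map_mx frac (1%:M *t map_mx (pconst g N) c).
  by rewrite map_mxT map_mx1 (map_mx_emb (emb' := emb)).
have BE : B = map_mx frac (1%:M *t map_mx (pconst g N) b).
  by rewrite map_mxT map_mx1 (map_mx_emb (emb' := emb)).
move: E; rewrite CE BE -!map_mxM -!map_mxZ => /matrixP E.
apply/matrixP => i j; have /eqP := E i j.
by rewrite [X in X == _]mxE [X in _ == X]mxE /= tofrac_eq => /eqP.
Qed.
End GenericFormula.

(** * Regularity forces the pencil to be invertible *)

(** Up to scalars, this is the inverse of the block upper triangular matrix
    with diagonal blocks L1, L2 and upper block - Z.  The isometries J1 and J2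
    replace an actual block decomposition, because the sizes of tensor products
    split only up to casts. *)
Lemma extend_inverse (R : comNzRingType) n a b (J1 : 'M[R]_(n, a)) (J2 : 'M_(n, b))
    (J1' : 'M_(a, n)) (J2' : 'M_(b, n)) L1 Z L2 M D :
  J1' *m J1 = 1%:M -> J1' *m J2 = 0 -> J2' *m J1 = 0 -> J2' *m J2 = 1%:M ->
  J1 *m J1' + J2 *m J2' = 1%:M -> L2 *m M = D%:M ->
  (J1 *m L1 *m J1' - J1 *m Z *m J2' + J2 *m L2 *m J2') *m
  (J1 *m (D *: \adj L1) *m J1' + J1 *m (\adj L1 *m Z *m M) *m J2' +
   J2 *m (\det L1 *: M) *m J2') = (\det L1 * D)%:M.
Proof.
move=> J11 J12 J21 J22 J LM; set L := (X in X *m _ = _).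
have LJ1 : L *m J1 = J1 *m L1.
  by rewrite !mulmxDl mulNmx -!mulmxA J11 J21 !mulmx0 mulmx1 subr0 addr0.
have LJ2 : L *m J2 = J2 *m L2 - J1 *m Z.
  by rewrite !mulmxDl mulNmx -!mulmxA J12 J22 !mulmx0 !mulmx1 add0r addrC.
rewrite !mulmxDr !mulmxA LJ1 LJ2 -!scalemxAr -(mulmxA J1) mul_mx_adj.
rewrite -!scalemxAl mul_mx_scalar -scalemxAl -!scalemxAl mulmxBl mulmxBl scalerBr.
rewrite -(mulmxA J2) LM mul_mx_scalar -scalemxAl !scalerA [D * _]mulrC.
by rewrite addrACA subrr addr0 -scalerDr J scalemx1.
Qed.

Section Core.
Variables (F : fieldType) (g m s d : nat).
Local Notation letter := ('I_m * 'I_g * 'I_m)%type.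
Variables (c : 'M[F]_(m, d)) (b : 'M[F]_(d, m)) (X : letter -> 'M[F]_d).
Variable y0 : letter -> 'M[F]_s.

Local Notation E := {poly {poly F}}.
(* The outer variable of E is h, the inner one is t; [at_point] is the evaluation
   at t = 1 and h = 0. *)
Let cst : {rmorphism F -> E} := polyC \o polyC.
Let lift : {rmorphism {poly F} -> E} := map_poly polyC.
Let tvar : E := 'X%:P.
Let hvar : E := 'X.
Let at_point : {rmorphism E -> F} := horner_eval 1 \o horner_eval (0 : {poly F}).
Let at_t0 : {rmorphism E -> {poly F}} := map_poly (horner_eval 0).

Let at_point_cst a : at_point (cst a) = a.
Proof. by rewrite /= /horner_eval !hornerC. Qed.
Let at_t0_cst a : at_t0 (cst a) = a%:P.
Proof. by rewrite /= map_polyC /= /horner_eval hornerC. Qed.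
Let at_t0_lift a : at_t0 (lift a) = a.
Proof.
apply/polyP => k; rewrite /at_t0 /lift /= !coef_map /= /horner_eval hornerC //.
Qed.
Let at_point_t : at_point tvar = 1.
Proof. by rewrite /= /horner_eval hornerC hornerX. Qed.
Let at_point_h : at_point hvar = 0.
Proof. by rewrite /= /horner_eval hornerX horner0. Qed.
Let at_t0_t : at_t0 tvar = 0.
Proof. by rewrite /= map_polyC /= /horner_eval hornerX. Qed.
Definition diag_pencil (mu : E) : 'M[E]_(s * d) :=
  pencil cst X (fun l => mu *: map_mx cst (y0 l)).

(** An element of [reach] records a point W, depending on t and h, with its
    quasi-inverse M of denominator D.  At t = 1, h = 0 the point is a direct sum of
    copies of y0; pi and om select a block of M, and G is this block at t = 0. *)
Definition reach (D : E) (G : 'M[{poly F}]_(s * d)) : Prop :=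
  exists k, (0 < k)%N /\ exists (W : letter -> 'M[E]_(k * s)) (pi : 'M[F]_(s, k * s))
    (om : 'M[F]_(k * s, s)) (M : 'M[E]_(k * s * d)),
  [/\ forall l, map_mx at_point (W l) = 1%:M *t y0 l,
      pencil cst X W *m M = D%:M, D != 0 &
      map_mx at_t0 ((map_mx cst pi *t 1%:M) *m M *m (map_mx cst om *t 1%:M)) = G].

(** The quasi-inverse M' comes from [extend_inverse]; only its upper blocks are
    recorded, since each step selects a block of the first block row. *)
Lemma extend_pencil k (W : letter -> 'M[E]_(k * s)) (M : 'M[E]_(k * s * d)) D mu
    (z : letter -> 'M[E]_(s, k * s)) :
  pencil cst X W *m M = D%:M ->
  let e1 := col_mx 1%:M 0 : 'M[E]_(s + k * s, s) in
  let e2 := col_mx 0 1%:M : 'M[E]_(s + k * s, k * s) in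
  let W' l : 'M[E]_(k.+1 * s) := block_mx (mu *: map_mx cst (y0 l)) (z l) 0 (W l) in
  let A := \adj (diag_pencil mu) in
  let Z := \sum_l z l *t map_mx cst (X l) in
  exists M' : 'M[E]_(k.+1 * s * d),
  [/\ pencil cst X W' *m M' = (\det (diag_pencil mu) * D)%:M,
      (e1^T *t 1%:M) *m M' *m (e1 *t 1%:M) = D *: A
    & (e1^T *t 1%:M) *m M' *m (e2 *t 1%:M) = A *m Z *m M].
Proof.
move=> WM e1 e2 W' A Z.
pose J1 : 'M[E]_(k.+1 * s * d, s * d) := e1 *t (1%:M : 'M_d).
pose J2 : 'M[E]_(k.+1 * s * d, k * s * d) := e2 *t (1%:M : 'M_d).
pose J1' : 'M[E]_(s * d, k.+1 * s * d) := e1^T *t (1%:M : 'M_d).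
pose J2' : 'M[E]_(k * s * d, k.+1 * s * d) := e2^T *t (1%:M : 'M_d).
have J11 : J1' *m J1 = 1%:M.
  rewrite tensmx_mul mulmx1 tr_col_mx mul_row_col trmx1 mulmx1 trmx0 mul0mx addr0.
  exact: tensmx11.
have J12 : J1' *m J2 = 0.
  rewrite tensmx_mul mulmx1 tr_col_mx mul_row_col trmx1 mulmx0 trmx0 mul0mx addr0.
  exact: tens0mx.
have J21 : J2' *m J1 = 0.
  rewrite tensmx_mul mulmx1 tr_col_mx mul_row_col trmx1 mulmx0 trmx0 mul0mx addr0.
  exact: tens0mx.
have J22 : J2' *m J2 = 1%:M.
  rewrite tensmx_mul mulmx1 tr_col_mx mul_row_col trmx1 mulmx1 trmx0 mul0mx add0r.
  exact: tensmx11.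
have eJ (P : 'M_s) Q R T (V : 'M[E]_d) :
    (block_mx P Q R T : 'M_(k.+1 * s)) *t V =
    J1 *m (P *t V) *m J1' + J1 *m (Q *t V) *m J2' +
    J2 *m (R *t V) *m J1' + J2 *m (T *t V) *m J2'.
  rewrite block_mx_sum !tensmxDl !tensmx_mul.
  by rewrite !mul1mx !mulmx1.
have J : J1 *m J1' + J2 *m J2' = 1%:M.
  have := eJ 1%:M 0 0 1%:M 1%:M; rewrite -scalar_mx_block tensmx11 => ->.
  by rewrite !tensmx11 !tens0mx !mulmx1 !mulmx0 !mul0mx !addr0.
have LE : pencil cst X W' = J1 *m diag_pencil mu *m J1' - J1 *m Z *m J2' +
    J2 *m pencil cst X W *m J2'.
  rewrite /diag_pencil /pencil !mulmxBr !mulmxBl !mulmx1 -J.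
  have -> : \sum_l W' l *t map_mx cst (X l) =
     J1 *m (\sum_l mu *: map_mx cst (y0 l) *t map_mx cst (X l)) *m J1' +
     J1 *m Z *m J2' + J2 *m (\sum_l W l *t map_mx cst (X l)) *m J2'.
    rewrite !mulmx_sumr !mulmx_suml -!big_split /=; apply: eq_bigr => l _.
    by rewrite eJ tens0mx mulmx0 mul0mx addr0.
  rewrite !opprD addrACA; congr (_ + _); exact: addrA.
rewrite LE; have := extend_inverse (diag_pencil mu) Z J11 J12 J21 J22 J WM.
set M' := (X in _ *m X = _) => LM'; exists M'; split=> //.
  rewrite -/J1' -/J1 /M' !mulmxDr !mulmxDl -!mulmxA J11 J21 !mulmx0 !addr0 !mulmxA J11.
  by rewrite !mul1mx mulmx1.
rewrite -/J1' -/J2 /M' !mulmxDr !mulmxDl -!mulmxA J12 J22 !mulmx0 !mulmxA J11 J12.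
by rewrite !mul1mx mul0mx !mulmx1 addr0 add0r.
Qed.

Let at_pointZ mu (A : 'M[F]_s) : at_point mu = 1 ->
  map_mx at_point (mu *: map_mx cst A) = A.
Proof.
move=> mu1; rewrite map_mxZ mu1 scale1r (map_mx_emb (emb' := idfun)) ?map_mx_id //.
Qed.

(** A single block: the empty point is extended once. *)
Lemma reach_base mu : at_point mu = 1 -> \det (diag_pencil mu) != 0 ->
  reach (\det (diag_pencil mu)) (map_mx at_t0 (\adj (diag_pencil mu))).
Proof.
move=> mu1 D0.
have W0 : pencil cst X (fun=> 0 : 'M[E]_(0 * s)) *m 1%:M = 1%:M.
  by apply/matrixP => -[i lt_i]; exfalso; move: lt_i; rewrite !mul0n.
have [M [WM ME _]] := extend_pencil mu (fun=> 0) W0.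
exists 1%N; split=> //; exists (fun l => block_mx (mu *: map_mx cst (y0 l)) 0 0 0).
exists (row_mx 1%:M 0 : 'M_(s, s + 0 * s)), (col_mx 1%:M 0 : 'M_(s + 0 * s, s)).
exists M; split=> [l||//|].
- rewrite (map_block_mx at_point) !map_mx0 at_pointZ // tens1_block.
  by congr block_mx; apply/matrixP => -[i lt_i]; exfalso; move: lt_i; rewrite ?mul0n.
- by rewrite WM mulr1.
- rewrite map_row_mx map_col_mx !map_mx1 !map_mx0.
  by move: ME; rewrite tr_col_mx trmx1 trmx0 scale1r => ->.
Qed.

(** The new block is linked to the one selected by pi, with coefficient 1 - t at
    the letter l: the link vanishes at t = 1 and becomes a unit at t = 0. *)
Lemma reach_step mu l D G : at_point mu = 1 -> \det (diag_pencil mu) != 0 ->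
  reach D G -> reach (\det (diag_pencil mu) * D)
    (map_mx at_t0 (\adj (diag_pencil mu)) *m (1%:M *t map_mx polyC (X l)) *m G).
Proof.
move=> mu1 D0 [k [k0 [W [pi [om [M [Wpt WM D'0 <-]]]]]]].
pose z l' : 'M[E]_(s, k * s) := if l' == l then (1 - tvar) *: map_mx cst pi else 0.
have [M' [WM' _ ME]] := extend_pencil mu z WM.
exists k.+1; split=> //; exists (fun l => block_mx (mu *: map_mx cst (y0 l)) (z l) 0 (W l)).
exists (row_mx 1%:M 0 : 'M_(s, s + k * s)), ((col_mx 0 1%:M : 'M_(s + k * s, k * s)) *m om).
exists M'; split=> [l'||//|].
- rewrite (map_block_mx at_point) !map_mx0 at_pointZ // Wpt [RHS]tens1_block.
  congr block_mx; rewrite /z; case: eqP => _; last by rewrite map_mx0.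
  by rewrite map_mxZ rmorphB rmorph1 at_point_t subrr scale0r.
- by rewrite WM'.
- by rewrite mulf_neq0.
- rewrite (map_mxM cst) map_row_mx map_col_mx !map_mx1 !map_mx0.
  have tE (e : 'M[E]_(k.+1 * s, k * s)) (o : 'M[E]_(k * s, s)) :
      (e *m o) *t (1%:M : 'M_d) = (e *t (1%:M : 'M_d)) *m (o *t (1%:M : 'M_d)).
    by rewrite tensmx_mul mulmx1.
  rewrite tE.
  move: ME; rewrite tr_col_mx trmx1 trmx0 mulmxA => ->.
  have -> : \sum_l' z l' *t map_mx cst (X l') =
      (1 - tvar) *: ((1%:M *t map_mx cst (X l)) *m (map_mx cst pi *t 1%:M)).
    rewrite (bigD1 l) //= big1 ?addr0 => [|l' Nl].
      by rewrite /z eqxx tensmxZl tensmx_mul mul1mx mulmx1.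
    by rewrite /z (negPf Nl) tens0mx.
  rewrite -!scalemxAr -!scalemxAl map_mxZ rmorphB rmorph1 at_t0_t subr0 scale1r.
  rewrite !map_mxM !mulmxA; congr (_ *m _ *m _ *m _ *m _).
  by rewrite map_mxT map_mx1 (map_mx_emb (emb' := polyC)).
Qed.

Let Lh : 'M[{poly F}]_(s * d) :=
  pencil polyC X (fun l => (1 - 'X) *: map_mx polyC (y0 l)).

Let pencil0 (R : comNzRingType) (emb : {rmorphism F -> R}) (y : letter -> 'M[R]_s) :
  (forall l, y l = 0) -> pencil emb X y = 1%:M.
Proof.
move=> y00; rewrite /pencil big1 ?subr0 // => l _.
by rewrite y00 tens0mx.
Qed.

Let adj_t : map_mx at_t0 (\adj (diag_pencil tvar)) = 1%:M.
Proof.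
rewrite map_mx_adj (map_pencil (emb' := polyC) _ (y' := fun=> 0)) ?pencil0 ?adj1 //.
by move=> l; rewrite map_mxZ at_t0_t scale0r.
Qed.

Let det_t : \det (diag_pencil tvar) != 0.
Proof.
have : at_t0 (\det (diag_pencil tvar)) != 0.
  rewrite -det_map_mx (map_pencil (emb' := polyC) _ (y' := fun=> 0)) ?pencil0 //.
    by rewrite det1 oner_eq0.
  by move=> l; rewrite map_mxZ at_t0_t scale0r.
by apply: contraNneq => ->; rewrite rmorph0.
Qed.

Let diag_h : diag_pencil (1 - hvar) = map_mx lift Lh.
Proof.
have liftE a : lift a%:P = cst a by rewrite /= map_polyC.
rewrite (map_pencil (emb' := cst) _ (y' := fun l => (1 - hvar) *: map_mx cst (y0 l))) //.
move=> l; rewrite map_mxZ rmorphB rmorph1 /= map_polyX.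
by rewrite (map_mx_emb (emb' := cst)).
Qed.

Let adj_h : map_mx at_t0 (\adj (diag_pencil (1 - hvar))) = \adj Lh.
Proof.
rewrite diag_h -map_mx_adj; apply/matrixP => i j.
by rewrite 2!mxE at_t0_lift.
Qed.

Let det_Lh : \det Lh != 0.
Proof.
have : horner_eval 1 (\det Lh) != 0.
  rewrite -det_map_mx (map_pencil (emb' := idfun) _ (y' := fun=> 0)) ?pencil0 //.
  - by rewrite det1 oner_eq0.
  - by move=> a; rewrite /= /horner_eval hornerC.
  - by move=> l; rewrite map_mxZ /= /horner_eval !hornerE subrr scale0r.
by apply: contraNneq => ->; rewrite rmorph0.
Qed.

Let det_h : \det (diag_pencil (1 - hvar)) = lift (\det Lh).
Proof. by rewrite diag_h det_map_mx. Qed.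

Let det_h0 : \det (diag_pencil (1 - hvar)) != 0.
Proof.
have : at_t0 (\det (diag_pencil (1 - hvar))) != 0 by rewrite det_h at_t0_lift.
by apply: contraNneq => ->; rewrite rmorph0.
Qed.

Let at_point_mu : at_point (1 - hvar) = 1.
Proof. by rewrite rmorphB rmorph1 at_point_h subr0. Qed.

Let xword_cons l w : ((1%:M : 'M_s) *t map_mx polyC (X l)) *m
    ((1%:M : 'M_s) *t map_mx polyC (xword X w)) =
  1%:M *t map_mx polyC (xword X (l :: w)).
Proof. by rewrite tensmx_mul mulmx1 -map_mxM. Qed.

(** With mu = t the new blocks sit at p when t = 0, and only contribute the
    letters of w. *)
Lemma reach_word w D G : reach D G -> exists D',
  reach (D' * D) ((1%:M *t map_mx polyC (xword X w)) *m G).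
Proof.
elim: w D G => [|l w IHw] D G DG.
  by exists 1; rewrite mul1r map_mx1 tensmx11 mul1mx.
have [D' {}DG] := IHw _ _ DG.
exists (\det (diag_pencil tvar) * D').
have := reach_step l at_point_t det_t DG; rewrite adj_t mul1mx mulrA mulmxA.
by rewrite xword_cons.
Qed.

(** The block (1 - h) y0 is the only one that still depends on h when t = 0; it
    contributes det L_h to the denominator. *)
Lemma reach_middle w : exists D,
  reach (D * lift (\det Lh)) (\adj Lh *m (1%:M *t map_mx polyC (xword X w))).
Proof.
rewrite -det_h -adj_h; case: w => [|l w].
  exists 1; rewrite mul1r map_mx1 tensmx11 mulmx1.
  exact: reach_base at_point_mu det_h0.
have [D DG] := reach_word w (reach_base at_point_t det_t).
have := reach_step l at_point_mu det_h0 DG.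
rewrite [X in _ *m (_ *m X)]adj_t mulmx1 -mulmxA xword_cons => {}DG.
by eexists; rewrite mulrC; apply: DG.
Qed.

(* The rational function (1 (x) c) L^-1 (1 (x) b) is regular at every direct sum of
   copies of y0: restricted to any family of points through it, this function
   is a quotient P / Q with Q nonzero at the parameters of the direct sum. *)
Hypothesis regular : forall k, (0 < k)%N ->
  forall (W : letter -> 'M[E]_(k * s)) (M : 'M[E]_(k * s * d)) D,
  (forall l, map_mx at_point (W l) = 1%:M *t y0 l) ->
  pencil cst X W *m M = D%:M -> D != 0 ->
  forall i j, exists Q P : E, at_point Q != 0 /\
    Q * ((1%:M *t map_mx cst c) *m M *m (1%:M *t map_mx cst b)) i j = D * P.

(** The denominator Q that regularity provides does not vanish at t = 1, h = 0,
    hence it is prime to h, and h^e has to divide the numerator.  This holds for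
    all t, in particular for t = 0. *)
Lemma reach_vanishes D G e : reach ('X^e * D) G ->
  vanishes e ((1%:M *t map_mx polyC c) *m G *m (1%:M *t map_mx polyC b)).
Proof.
move=> [k [k0 [W [pi [om [M [Wpt WM D0 <-]]]]]]].
have van : vanishes e ((1%:M *t map_mx cst c) *m M *m (1%:M *t map_mx cst b)).
  move=> i j; have [Q [P [Q0 QP]]] := regular k0 Wpt WM D0 i j.
  apply: (@coef_div_low _ _ Q).
    apply: contraNneq Q0 => Q0.
    by rewrite /= /horner_eval horner_coef0 Q0 horner0.
  by move=> k' ke; rewrite QP -mulrA coefXnM ke.
have -> : (1%:M *t map_mx polyC c) *m
    map_mx at_t0 ((map_mx cst pi *t 1%:M) *m M *m (map_mx cst om *t 1%:M)) *m
    (1%:M *t map_mx polyC b) = map_mx at_t0 ((map_mx cst pi *t 1%:M) *m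
    ((1%:M *t map_mx cst c) *m M *m (1%:M *t map_mx cst b)) *m
    (map_mx cst om *t 1%:M)).
  have E1 : 1%:M *t map_mx polyC c = map_mx at_t0 (1%:M *t map_mx cst c) :> 'M_(s * m, s * d).
    by rewrite map_mxT map_mx1 (map_mx_emb (emb' := polyC)).
  have E2 : 1%:M *t map_mx polyC b = map_mx at_t0 (1%:M *t map_mx cst b) :> 'M_(s * d, s * m).
    by rewrite map_mxT map_mx1 (map_mx_emb (emb' := polyC)).
  rewrite E1 E2 -!map_mxM; congr map_mx.
  rewrite !mulmxA tensmx_mul mul1mx mulmx1 -!mulmxA tensmx_mul mul1mx mulmx1.
  by rewrite !mulmxA [in RHS]tensmx_mul mul1mx mulmx1 -!mulmxA [in RHS]tensmx_mul mul1mx mulmx1.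
move=> i j k' ke; rewrite mxE coef_map /=.
rewrite (vanishes_mulr _ (vanishes_mull _ van)) //.
by rewrite /horner_eval horner0.
Qed.

Hypothesis m_gt0 : (0 < m)%N.
Hypothesis observable : forall v : 'M[F]_(d, m),
  (forall w, c *m xword X w *m v = 0) -> v = 0.
Hypothesis controllable : forall u : 'M[F]_(m, d),
  (forall w, u *m xword X w *m b = 0) -> u = 0.

(** Any coordinate of the first tensor factor can be treated separately; the
    vector found there is repeated in m columns, to apply the hypothesis. *)
Let tens1_injective (I : Type) (fam : I -> 'M[F]_(m, d)) :
  (forall v : 'M_(d, m), (forall i, fam i *m v = 0) -> v = 0) ->
  forall t (x : 'M_(s * d, t)),
  (forall i, ((1%:M : 'M_s) *t fam i) *m x = 0) -> x = 0.
Proof.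
move=> inj t x x0; apply/matrixP => i j; case: (mxtens_indexP i) => a i'.
pose v : 'M_(d, m) := \matrix_(i, k) x (mxtens_index (a, i)) j.
have /matrixP/(_ i' (Ordinal m_gt0)) : v = 0; last by rewrite !mxE.
apply: inj => k; apply/matrixP => u1 u2.
have /matrixP/(_ (mxtens_index (a, u1)) j) := x0 k.
rewrite mxE [X in _ = X]mxE => E0; rewrite mxE [RHS]mxE -[RHS]E0.
rewrite sum_mxtens (bigD1 a) //=.
rewrite [X in _ = _ + X]big1 ?addr0 => [|a' Na].
  by apply: eq_bigr => i1 _; rewrite tensmxE !mxE eqxx mul1r.
by apply: big1 => i1 _; rewrite tensmxE !mxE eq_sym (negPf Na) !mul0r.
Qed.

Lemma pencil_unit : pencil idfun X y0 \in unitmx.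
Proof.
have [e [u]] := multiplicity_XsubC (\det Lh) 0.
rewrite det_Lh subr0 => /= u0 detE.
have van w w' : vanishes e (((1%:M : 'M_s) *t map_mx polyC (c *m xword X w)) *m
    \adj Lh *m ((1%:M : 'M_s) *t map_mx polyC (xword X w' *m b))).
  have [D1 /(reach_word w)[D2]] := reach_middle w'.
  have -> : D2 * (D1 * lift (\det Lh)) = 'X^e * (D2 * D1 * lift u).
    by rewrite detE rmorphM rmorphXn /= map_polyX [RHS]mulrC !mulrA.
  move=> /reach_vanishes; rewrite !map_mxM !mulmxA tensmx_mul mulmx1.
  by rewrite -!mulmxA tensmx_mul mulmx1 !mulmxA.
(* Observability cancels the factors on the left, and controllability, after
   transposition, those on the right, coefficient by coefficient in h. *)
have adj_van : vanishes e (\adj Lh).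
  move=> i j k ke; set A := \adj Lh in van *.
  have Ak a b' a' b'' (U : 'M[F]_(a, b')) (V : 'M[F]_(a', b'')) (B : 'M[{poly F}]_(b', a')) :
      map_mx (coefp k) (map_mx polyC U *m B *m map_mx polyC V) = U *m map_mx (coefp k) B *m V.
    apply/matrixP => i' j'; rewrite !mxE /= coef_sum; apply: eq_bigr => l _.
    rewrite !mxE coefMC coef_sum; congr (_ * _); apply: eq_bigr => l' _.
    by rewrite !mxE coefCM.
  suff /matrixP/(_ i j) : map_mx (coefp k) A = 0 by rewrite !mxE.
  apply: (tens1_injective (fam := fun w => c *m xword X w) observable) => w.
  apply: trmx_inj; rewrite trmx0.
  apply: (tens1_injective (fam := fun w => (xword X w *m b)^T)) => [v v0|w'].
    apply: trmx_inj; rewrite trmx0; apply: controllable => w'.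
    by apply: trmx_inj; rewrite trmx0 -mulmxA trmx_mul trmxK v0.
  rewrite -[1%:M]trmx1 -trmx_tens -trmx_mul; apply: trmx_inj; rewrite trmx0 trmxK.
  have := van w w'.
  have tC (M : 'M[F]_(m, d)) : (1%:M : 'M_s) *t map_mx polyC M = map_mx polyC (1%:M *t M).
    by rewrite map_mxT map_mx1.
  have tC' (M : 'M[F]_(d, m)) : (1%:M : 'M_s) *t map_mx polyC M = map_mx polyC (1%:M *t M).
    by rewrite map_mxT map_mx1.
  rewrite tC tC' => van_k; rewrite -Ak; apply/matrixP => i' j'.
  by rewrite mxE [RHS]mxE trmx1; apply: van_k.
have [A' AE] := vanishes_div adj_van.
have LA : Lh *m A' = u%:M.
  have := mul_mx_adj Lh; rewrite AE -scalemxAr detE mulrC -mul_scalar_mx.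
  rewrite scalar_mxM mul_scalar_mx mul_scalar_mx => /matrixP E.
  apply/matrixP => i j; apply: (@mulfI _ ('X^e)); first by rewrite monic_neq0 ?monicXn.
  by have := E i j; rewrite [X in X = _]mxE [X in _ = X]mxE.
have := congr1 (map_mx (horner_eval 0)) LA.
rewrite map_mxM map_scalar_mx (map_pencil (emb' := idfun) _ (y' := y0)).
- move=> LA0; have : \det (pencil idfun X y0) * \det (map_mx (horner_eval 0) A') != 0.
    by rewrite -det_mulmx LA0 det_scalar expf_neq0.
  by rewrite mulf_eq0 negb_or unitmxE unitfE => /andP[].
- by move=> a; rewrite /= /horner_eval hornerC.
- move=> l; rewrite map_mxZ (map_mx_emb (emb' := idfun)) => [|a]; last first.
    by rewrite /= /horner_eval hornerC.
  by rewrite map_mx_id // rmorphB rmorph1 /= /horner_eval hornerX subr0 scale1r.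
Qed.

End Core.

(** * From realizations to pencils over the field *)

Section Flattening.
Variables (F : fieldType) (g m n : nat).
Local Notation letter := ('I_m * 'I_g * 'I_m)%type.
Local Notation d := (\sum_(i < n) m)%N.
Variable A : 'I_g -> 'M[gseries F g m]_n.

(** The letter (u, k, v) stands for the products e_iu x_k e_vj with arbitrary i
    and j, and [flat_letter] collects its coefficients in A. *)
Definition flat_letter (l : letter) : 'M[F]_d :=
  \mxblock_(i < n, j < n) gcoef (A l.1.2 i j) [:: l].

Definition flat_row (u : 'rV['M[F]_m]_n) : 'M[F]_(m, d) := \mxrow_(j < n) u 0 j.
Definition flat_col (v : 'cV['M[F]_m]_n) : 'M[F]_(d, m) := \mxcol_(i < n) v i 0.

Hypothesis homA : forall k i j, in_comp [:: k] (A k i j).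

Lemma gcoef_linear k i j l w : gcoef (A k i j) (l :: w) =
  if (l.1.2 == k) && (w == [::]) then gcoef (A k i j) [:: l] else 0.
Proof.
rewrite -{1}(homA k i j) /=.
have -> : (gword (l :: w) == [:: k]) = (l.1.2 == k) && (w == [::]).
  by rewrite /gword /= eqseq_cons; case: w.
by case: w => [|? ?]; rewrite ?andbF.
Qed.

Lemma gcoef_mul_linear k i j T l w : gcoef (A k i j * T) (l :: w) =
  if l.1.2 == k then gcoef (A k i j) [:: l] *m gcoef T w else 0.
Proof.
rewrite [LHS]gmul_cons.
have -> : gcoef (A k i j) [::] = 0 by rewrite -(homA k i j).
rewrite mul0mx add0r [LHS]/= big_ord_recl take0 drop0 big1 ?addr0 => [|d' _].
  by rewrite gcoef_linear eqxx andbT; case: eqP => // _; rewrite mul0mx.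
rewrite gcoef_linear [_ == [::]](_ : _ = false) ?andbF ?mul0mx //.
by case: w d' => [|? ?] [d' /= lt_d].
Qed.

Lemma gcoef_mul_linear_nil k i j T : gcoef (A k i j * T) [::] = 0.
Proof.
by rewrite [LHS]gmul_nil -(homA k i j) mul0mx.
Qed.

(** As A^k is homogeneous of degree one in x_k, a coefficient at a word of length
    n arises from one letter in each of n factors. *)
Lemma gcoef_wordmx_col (v : 'cV['M[F]_m]_n) om w i :
  gcoef ((wordmx A om *m gconst_mx g v) i 0) w =
  if gword w == om then submxcol (xword flat_letter w *m flat_col v) i else 0.
Proof.
elim: om w i => [|k om IH] w i.
  rewrite /wordmx big_nil [X in gcoef X](_ : _ = gconst (v i 0)); last first.
    by rewrite mul1mx mxE.
  by case: w => [|? ?] //=; rewrite mul1mx mxcolK.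
rewrite /wordmx big_cons -/(wordmx A om) -mulmxE -mulmxA mxE gcoef_sum.
case: w => [|l w].
  by rewrite big1 // => j _; rewrite gcoef_mul_linear_nil.
under eq_bigr do rewrite gcoef_mul_linear IH.
rewrite /= eqseq_cons; case: eqP => [<-|_] /=; last by rewrite big1.
case: eqP => _; last by rewrite big1 // => j _; rewrite mulmx0.
rewrite -mulmxA -[xword _ w *m _]submxcolK mul_mxblock_mxrow mxcolK.
by apply: eq_bigr => j _; rewrite mxcolK.
Qed.

Lemma gcoef_wordmx (u : 'rV['M[F]_m]_n) (v : 'cV['M[F]_m]_n) om w :
  gcoef ((gconst_mx g u *m wordmx A om *m gconst_mx g v) 0 0) w =
  if gword w == om then flat_row u *m xword flat_letter w *m flat_col v else 0.
Proof.
rewrite -mulmxA mxE gcoef_sum.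
under eq_bigr do rewrite mxE gcoef_constM gcoef_wordmx_col.
case: eqP => _; last by rewrite big1 // => j _; rewrite mulmx0.
by rewrite -mulmxA -[X in _ = _ *m X]submxcolK mul_mxrow_mxcol.
Qed.

Lemma flat_realization S c b : representation S c A b ->
  forall w, gcoef S w = flat_row c *m xword flat_letter w *m flat_col b.
Proof.
move=> [_ SE] w; have := congr1 (fun T => gcoef T w) (SE (gword w)).
by rewrite gcoef_wordmx /= eqxx.
Qed.

Lemma mxrow_flat (u : 'M[F]_(m, d)) :
  u = flat_row (\row_j submxrow u j).
Proof. by rewrite /flat_row -[LHS]submxrowK; apply: eq_mxrow => j; rewrite mxE. Qed.

Lemma mxcol_flat (v : 'M[F]_(d, m)) :
  v = flat_col (\col_i submxcol v i).
Proof. by rewrite /flat_col -[LHS]submxcolK; apply: eq_mxcol => j; rewrite mxE. Qed.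

Lemma flat_row0 : flat_row 0 = 0.
Proof. by rewrite -[RHS]mxrow0; apply: eq_mxrow => j; rewrite mxE. Qed.

Lemma flat_col0 : flat_col 0 = 0.
Proof. by rewrite -[RHS]mxcol0; apply: eq_mxcol => j; rewrite mxE. Qed.

Lemma flat_observable c b : totally_reduced c A b -> forall v : 'M[F]_(d, m),
  (forall w, flat_row c *m xword flat_letter w *m v = 0) -> v = 0.
Proof.
move=> [_ obs] v v0; rewrite [v]mxcol_flat (obs (\col_i submxcol v i)) ?flat_col0 //.
move=> om; apply/matrixP => i j; rewrite !ord1 [RHS]mxE; apply: gseriesP => w.
by rewrite gcoef_wordmx -mxcol_flat v0 if_same.
Qed.

Lemma flat_controllable c b : totally_reduced c A b -> forall u : 'M[F]_(m, d),
  (forall w, u *m xword flat_letter w *m flat_col b = 0) -> u = 0.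
Proof.
move=> [ctr _] u u0; rewrite [u]mxrow_flat (ctr (\row_j submxrow u j)) ?flat_row0 //.
move=> om; apply/matrixP => i j; rewrite !ord1 [RHS]mxE; apply: gseriesP => w.
by rewrite gcoef_wordmx -mxrow_flat u0 if_same.
Qed.

Variable s : nat.

Lemma gsubst_tblock k (Q : 'M[F]_(s * m)) (T : gseries F g m) :
  gsubst k Q T = \sum_u \sum_v tblock Q u v *t gcoef T [:: (u, k, v)].
Proof.
have sub u v i j : iota_mx s (delta_mx i u) *m Q *m iota_mx s (delta_mx v j) =
    tblock Q u v *t delta_mx i j.
  rewrite {1}[Q]tblock_sum mulmx_sumr mulmx_suml (bigD1 u) //=.
  rewrite [X in _ + X]big1 ?addr0 => [|u' Nu]; last first.
    rewrite mulmx_sumr mulmx_suml big1 // => v' _.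
    by rewrite tensmx_mul mul_delta_mx_0 1?eq_sym // tensmx0 mul0mx.
  rewrite mulmx_sumr mulmx_suml (bigD1 v) //= [X in _ + X]big1 ?addr0 => [|v' Nv].
    by rewrite !tensmx_mul !mul_delta_mx mul1mx mulmx1.
  by rewrite !tensmx_mul mul_delta_mx mul_delta_mx_0 // tensmx0.
apply: eq_bigr => u _; apply: eq_bigr => v _.
rewrite [X in _ *t X]matrix_sum_delta tensmx_sumr; apply: eq_bigr => i _.
by rewrite tensmx_sumr; apply: eq_bigr => j _; rewrite sub tensmxZr.
Qed.

(** P is the permutation matrix between the two orders of the three indices
    (i < n, a < s, x < m) that the pencil and the flattened matrix use; it is written
    with block rows and tensor products to avoid computing with indices. *)
Let E (i : 'I_n) : 'M[F]_(d, m) := submxrow 1%:M i.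
Let E' (i : 'I_n) : 'M[F]_(m, d) := submxcol 1%:M i.
Let P : 'M[F]_(s * d, \sum_(i < n) s * m) := \mxrow_(i < n) ((1%:M : 'M_s) *t E i).
Let P' : 'M[F]_(\sum_(i < n) s * m, s * d) := \mxcol_(i < n) ((1%:M : 'M_s) *t E' i).

Let PK : P *m P' = 1%:M.
Proof.
rewrite mul_mxrow_mxcol; under [LHS]eq_bigr do rewrite tensmx_mul mul1mx.
have EE' : \sum_i E i *m E' i = 1%:M.
  by rewrite -[LHS]mul_mxrow_mxcol submxrowK submxcolK mul1mx.
by rewrite -tensmx_sumr EE' tensmx11.
Qed.

Let conj_tens (Y : 'M[F]_s) (Z : 'M[F]_d) :
  P' *m (Y *t Z) *m P = \mxblock_(i, j) (Y *t submxblock Z i j).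
Proof.
rewrite mxcol_mul mul_mxcol_mxrow; apply: eq_mxblock => i j.
rewrite !tensmx_mul mul1mx mulmx1 submxcol_mul mul1mx mul_submxrow mulmx1.
by rewrite submxblockEv.
Qed.

Let P'K : P' *m P = 1%:M.
Proof.
have := conj_tens 1%:M 1%:M; rewrite tensmx11 mulmx1 => ->.
have sub1 i j : submxblock (1%:M : 'M[F]_d) i j = if i == j then 1%:M else 0.
  rewrite -mxdiagZ /mxdiag mxblockK; case: eqP => // _; exact: conform_mx_id.
rewrite -[RHS]mxdiagZ; apply: eq_mxblock => i j; rewrite sub1.
by case: eqP => _; rewrite ?conform_mx_id ?tensmx11 ?tensmx0.
Qed.

Variable Q : 'I_g -> 'M[F]_(s * m).
Let coord (l : letter) : 'M[F]_s := tblock (Q l.1.2) l.1.1 l.2.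

Lemma flat_pencil : 1%:M - \sum_(k < g) gsubst_mx A k (Q k) =
  P' *m pencil idfun flat_letter coord *m P.
Proof.
rewrite /pencil mulmxBr mulmxBl mulmx1 P'K; congr (_ - _).
rewrite sum_triple mulmx_sumr mulmx_suml.
under [RHS]eq_bigr do rewrite mulmx_sumr mulmx_suml.
rewrite exchange_big /=; apply: eq_bigr => k _.
rewrite /gsubst_mx.
under eq_mxblock do rewrite gsubst_tblock.
rewrite mxblock_sum; apply: eq_bigr => u _; rewrite mxblock_sum mulmx_sumr mulmx_suml.
apply: eq_bigr => v _; rewrite map_mx_id // conj_tens; apply: eq_mxblock => i j.
by rewrite mxblockK.
Qed.

Lemma flat_pencil_unit : 
  (\det (1%:M - \sum_(k < g) gsubst_mx A k (Q k)) != 0) =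
  (pencil idfun flat_letter coord \in unitmx).
Proof.
rewrite -unitfE -unitmxE flat_pencil; apply/idP/idP => U.
  have -> : pencil idfun flat_letter coord =
      P *m (P' *m pencil idfun flat_letter coord *m P) *m P'.
    by rewrite !mulmxA PK mul1mx -mulmxA PK mulmx1.
  have /mulmx1_unit[] // : (P *m (P' *m pencil idfun flat_letter coord *m P) *m P') *m
      (P *m invmx (P' *m pencil idfun flat_letter coord *m P) *m P') = 1%:M.
  move: (P' *m _ *m P) U => M U.
  by rewrite !mulmxA -(mulmxA _ P' P) P'K mulmx1 -(mulmxA P) mulmxV // mulmx1 PK.
have /mulmx1_unit[] // : (P' *m pencil idfun flat_letter coord *m P) *m
   (P' *m invmx (pencil idfun flat_letter coord) *m P) = 1%:M.
by rewrite !mulmxA -(mulmxA _ P P') PK mulmx1 -(mulmxA P') mulmxV // mulmx1 P'K.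
Qed.

End Flattening.

(** * Stable extended domains *)

Section Casts.
Variables (F : fieldType) (g : nat).

Lemma mxvalue_cast a b (e : a = b) (z : 'I_g -> 'M[F]_a) r v :
  mxvalue z r v -> mxvalue (fun k => castmx (e, e) (z k)) r (castmx (e, e) v).
Proof.
case: _ / e; rewrite castmx_id; apply: (rvalue_map (Psi := idfun)) => //= k.
Qed.

Lemma edom_cast a b (e : a = b) (z : 'I_g -> 'M[F]_a) r :
  edom r (fun k => castmx (e, e) (z k)) <-> edom r z.
Proof.
case: _ / e; have -> : (fun k => castmx (erefl, erefl) (z k)) = z => //.
Qed.

(** The two expressions and rb may fail to be simultaneously defined at any
    matrices of the given size m.  They are at size M m, where M is the size of
    a point at which rb is defined: there the three generic values coincide, and
    direct sums of M copies of a point of size m are admissible points. *)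
Lemma requiv_trans (charF0 : [pchar F] =i pred0) (rb r1 r2 : rexpr F g) :
  Defs.nondegenerate rb -> requiv rb r1 -> requiv rb r2 -> requiv r1 r2.
Proof.
move=> [M [M_gt0 [ab [vb rbP]]]] eq1 eq2 m m_gt0 a v1 v2 r1P r2P.
have N_gt0 : (0 < M * m)%N by rewrite muln_gt0 M_gt0.
have {}rbP : mxvalue (fun k => castmx (mulnC m M, mulnC m M) (iota_mx m (ab k))) rb
    (castmx (mulnC m M, mulnC m M) (iota_mx m vb)).
  exact/mxvalue_cast/mxvalue_iota.
have {}r1P := mxvalue_iota M r1P; have {}r2P := mxvalue_iota M r2P.
pose a' k := iota_mx M (a k).
have r1P' := (mxvalueP _ _ _).1 r1P; have r2P' := (mxvalueP _ _ _).1 r2P.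
have [D1 [P1 [D1n ex1 val1]]] := clear_denominators r1P'.
have [D2 [P2 [D2n ex2 val2]]] := clear_denominators r2P'.
have [Db [Pb [Dbn exb _]]] := clear_denominators ((mxvalueP _ _ _).1 rbP).
have frac0 (D : tpoly F g (M * m)) z : eval_at z D != 0 -> tofrac D != 0.
  by rewrite tofrac_eq0; apply: contraNneq => ->; rewrite rmorph0.
have [R1 R1P] := ex1 _ (@tofrac (tpoly F g (M * m))) (frac0 _ _ D1n).
have [R2 R2P] := ex2 _ (@tofrac (tpoly F g (M * m))) (frac0 _ _ D2n).
have [Rb /generic_valueP RbP] := exb _ (@tofrac (tpoly F g (M * m))) (frac0 _ _ Dbn).
have E1 := generic_value_equiv charF0 N_gt0 eq1 RbP ((generic_valueP _ _).2 R1P).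
have E2 := generic_value_equiv charF0 N_gt0 eq2 RbP ((generic_valueP _ _).2 R2P).
have := val1 _ _ _ R1P; have := val2 _ _ _ R2P.
rewrite !map_scalar_mulE -E1 -E2 => F2 F1.
have PE : D2 *: P1 = D1 *: P2.
  apply/matrixP => i j; apply/eqP; rewrite -tofrac_eq; apply/eqP.
  have /matrixP/(_ i j) := F1; have /matrixP/(_ i j) := F2.
  by rewrite !mxE !tofracM => <- <-; rewrite mulrCA.
have := val1 _ _ _ r1P'; have := val2 _ _ _ r2P'.
rewrite !map_scalar_mulE => G2 G1.
have : iota_mx M v1 = iota_mx M v2.
  have := congr1 (map_mx (eval_at a')) PE; rewrite !map_mxZ -G1 -G2 !scalerA mulrC.
  by apply: scalerI; rewrite mulf_neq0.
move=> /matrixP v12; apply/matrixP => i j.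
have := v12 (mxtens_index (Ordinal M_gt0, i)) (mxtens_index (Ordinal M_gt0, j)).
by rewrite !tensmxE !mxE eqxx !mul1r.
Qed.

End Casts.

Lemma mulf_cancel (K : fieldType) (a e f x : K) :
  a != 0 -> a * e * (f * (x / a)) = f * e * x.
Proof.
move=> a0; rewrite !mulrA -(mulrA a) -(mulrA a) [a * _]mulrC mulfK //.
by rewrite [e * f]mulrC.
Qed.

Section RegularityDomain.
Variables (F : fieldType) (g m d : nat).
Hypothesis m_gt0 : (0 < m)%N.
Local Notation letter := ('I_m * 'I_g * 'I_m)%type.
Variables (p : 'I_g -> 'M[F]_m) (c : 'M[F]_(m, d)) (b : 'M[F]_(d, m)).
Variable (X : letter -> 'M[F]_d).
Variables (r : rexpr F g) (v : 'M[F]_m) (S : gseries F g m).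
Hypotheses (rp : mxvalue p r v) (expS : expansion r p S).
Hypothesis SE : forall w, gcoef S w = c *m xword X w *m b.

Lemma eval_generic_pencil s (q : 'I_g -> 'M[F]_(s * m)) :
  map_mx (eval_at q) (generic_pencil s p X) = pencil idfun X (local_coord idfun p q).
Proof.
have evC a : eval_at q (pconst g (s * m) a) = a by rewrite /= mevalC.
rewrite (map_pencil (emb' := idfun) _ (y' := local_coord idfun p q)) // => l.
rewrite (map_local_coord (emb' := idfun)) //.
by congr local_coord; apply/funext => k; rewrite eval_var_mx.
Qed.

(** The formula for the generic value has det L as its only denominator. *)
Lemma edom_of_unit s (q : 'I_g -> 'M[F]_(s * m)) : (0 < s)%N ->
  pencil idfun X (local_coord idfun p q) \in unitmx -> edom r q.
Proof.
move=> s_gt0 Lq; have [D [P [D0 [R RP RE] PE]]] := generic_formula m_gt0 s_gt0 rp expS SE.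
exists R => // i j; set L := generic_pencil s p X in PE.
move: PE; set Z := (X in _ = D *: X); move=> PE.
exists (Z i j), (\det L); split.
  rewrite [_.@[_]](_ : _ = eval_at q (\det L)) // -det_map_mx.
  rewrite eval_generic_pencil; last by rewrite -unitfE -unitmxE.
have detL0 : tofrac (\det L) != 0.
  rewrite tofrac_eq0; apply: contraTneq Lq => det0.
  have := congr1 (eval_at q) det0; rewrite rmorph0 -det_map_mx.
  rewrite eval_generic_pencil => det0'.
  by rewrite unitmxE unitfE det0' eqxx.
apply: (@mulfI _ (tofrac D)); first by rewrite tofrac_eq0.
have /matrixP/(_ i j) := RE; have /matrixP/(_ i j) := PE; rewrite !mxE => PZ ->.
by rewrite mulrA -tofracM -PZ tofracM mulrC mulKf.
Qed.

Lemma tblock_cast s k (e : (k * (s * m) = k * s * m)%N) (Q : 'M[F]_(s * m)) u w :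
  tblock (castmx (e, e) (iota_mx k Q)) u w = 1%:M *t tblock Q u w.
Proof.
apply/matrixP => x y; case: (mxtens_indexP x) => {x} x1 x2.
case: (mxtens_indexP y) => {y} y1 y2; rewrite tensmxE mxE castmxE.
by rewrite !cast_mxtens_index tensmxE [tblock _ _ _ _ _]mxE.
Qed.

Lemma local_coord_cast s k (e : (k * (s * m) = k * s * m)%N) (q : 'I_g -> 'M[F]_(s * m)) l :
  local_coord idfun p (fun j => castmx (e, e) (iota_mx k (q j))) l =
  1%:M *t local_coord idfun p q l.
Proof.
by rewrite /local_coord tblock_cast tensmxBr tensmx_scalar mul1r.
Qed.

Lemma pencil_cast (E : comNzRingType) (cst : {rmorphism F -> E}) s k
    (e : (k * (s * d) = k * s * d)%N) (y : letter -> 'M[E]_s) :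
  pencil cst X (fun l => (1%:M : 'M_k) *t y l) = castmx (e, e) (1%:M *t pencil cst X y).
Proof.
have castB (Y Y' : 'M[E]_(k * (s * d))) :
    castmx (e, e) (Y - Y') = castmx (e, e) Y - castmx (e, e) Y'.
  by case: _ / e; rewrite !castmx_id.
have castS (Y : letter -> 'M[E]_(k * (s * d))) :
    castmx (e, e) (\sum_l Y l) = \sum_l castmx (e, e) (Y l).
  by clear castB; case: _ / e; rewrite castmx_id; apply: eq_bigr => l _; rewrite castmx_id.
have cast1 : castmx (e, e) (1%:M : 'M[E]_(k * (s * d))) = 1%:M.
  by clear castB castS; case: _ / e; rewrite castmx_id.
rewrite /pencil tensmxBr tensmx11 castB cast1 tensmx_sumr castS; congr (_ - _).
by apply: eq_bigr => l _; rewrite tensmxA.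
Qed.

(** Regularity at I_k (x) q provides a denominator Q1 with Q1 (1 (x) c) adj(L)
    (1 (x) b) = det(L) P1, a polynomial identity.  It can be specialized to any
    family of points W, where adj(L) / det(L) equals M / D. *)
Lemma regular_on_curves (charF0 : [pchar F] =i pred0) (E : idomainType)
    (cst : {rmorphism F -> E}) (at_point : {rmorphism E -> F})
    s k (q : 'I_g -> 'M[F]_(s * m)) r' :
  (forall a, at_point (cst a) = a) -> (0 < s)%N -> (0 < k)%N ->
  requiv r r' -> edom r' (fun j => iota_mx k (q j)) ->
  forall (W : letter -> 'M[E]_(k * s)) (M : 'M[E]_(k * s * d)) D,
  (forall l, map_mx at_point (W l) = 1%:M *t local_coord idfun p q l) ->
  pencil cst X W *m M = D%:M -> D != 0 ->
  forall i j, exists Q P : E, at_point Q != 0 /\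
    Q * ((1%:M *t map_mx cst c) *m M *m (1%:M *t map_mx cst b)) i j = D * P.
Proof.
move=> cstK s_gt0 k_gt0 rr' rq W M D0 Wq WM D0n i j.
have ks_gt0 : (0 < k * s)%N by rewrite muln_gt0 k_gt0.
have N_gt0 : (0 < k * s * m)%N by rewrite muln_gt0 ks_gt0.
pose e := mulnA k s m; pose a l := castmx (e, e) (iota_mx k (q l)).
have [R' R'P reg] := (edom_cast e _ _).2 rq.
have [D [P [Dn [R RP RE] PE]]] := generic_formula m_gt0 ks_gt0 rp expS SE.
have RR' := generic_value_equiv charF0 N_gt0 rr' RP R'P.
have [P1 [Q1 [Q1n /= R1]]] := reg i j.
set L := generic_pencil (k * s) p X in PE.
pose Z := (1%:M *t map_mx (pconst g (k * s * m)) c) *m \adj L *m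
  (1%:M *t map_mx (pconst g (k * s * m)) b).
have QZ : (Q1 : tpoly F g (k * s * m)) * Z i j = \det L * P1.
  apply: (@mulfI _ D) => //.
  have /matrixP/(_ i j) := PE; rewrite -/Z [LHS]mxE [RHS]mxE => PZ.
  have Q1n' : tofrac (Q1 : tpoly F g (k * s * m)) != 0.
    by rewrite tofrac_eq0; apply: contraNneq Q1n => ->; rewrite meval0.
  rewrite mulrCA -PZ !mulrA; apply/eqP; rewrite -tofrac_eq !tofracM; apply/eqP.
  have /matrixP/(_ i j) := RE; rewrite RR' mxE R1 [RHS]mxE => <-.
  exact: mulf_cancel.
pose T l : 'M[E]_(k * s * m) := \sum_u \sum_w W (u, l, w) *t delta_mx u w
   + 1%:M *t map_mx cst (p l).
pose var_at (x : 'I_#|tindex g (k * s * m)|) : E := let: (l, u, w) := enum_val x in T l u w.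
pose theta := mmap cst var_at : {rmorphism tpoly F g (k * s * m) -> E}.
have thetaC x : theta (pconst g (k * s * m) x) = cst x by rewrite /theta /= mmapC.
have thetaT l : map_mx theta (var_mx F (k * s * m) l) = T l.
  by apply: map_var_mx => {}l u w; rewrite /theta /= mmapX mmap1U /var_at enum_rankK.
have thetaL : map_mx theta L = pencil cst X W.
  rewrite (map_pencil (emb' := cst) _ (y' := W)) // => -[[u l] w].
  rewrite (map_local_coord (emb' := cst)) // local_coordE thetaT addrK.
  by rewrite (tblock_sumK (fun u w => W (u, l, w))).
have evT l : map_mx at_point (T l) = a l.
  rewrite map_mxD map_mxT map_mx1 (map_mx_emb (emb' := idfun)) //.
  rewrite -[RHS](subrK (1%:M *t map_mx idfun (p l))) -local_coordK; congr (_ + _).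
  rewrite raddf_sum; apply: eq_bigr => u _; rewrite raddf_sum; apply: eq_bigr => w _.
  by rewrite /= map_mxT map_delta_mx Wq local_coord_cast.
have evQ : at_point (theta Q1) = Q1.@[tpoint a].
  apply: (mpoly_rmorph_ext (f1 := at_point \o theta) (f2 := eval_at a)) => [x|x].
    by rewrite /= [theta _]thetaC cstK mevalC.
  rewrite /= -(enum_valK x); case: (enum_val x) => [[l u] w].
  have -> : mmap cst var_at 'X_(enum_rank ((l, u, w) : tindex g (k * s * m))) = T l u w.
    by rewrite -thetaT !mxE.
  have := evT l => /matrixP/(_ u w); rewrite mxE => ->.
  by rewrite mevalXU /tpoint enum_rankK.
exists (theta Q1), (theta P1); split; first by rewrite evQ.
have := congr1 theta QZ; rewrite !rmorphM -det_map_mx thetaL.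
set LW := pencil cst X W in WM *.
set C := 1%:M *t map_mx cst c; set B := 1%:M *t map_mx cst b.
have -> : theta (Z i j) = (C *m \adj LW *m B) i j.
  have -> : C *m \adj LW *m B = map_mx theta Z.
    by rewrite !map_mxM map_mx_adj thetaL !map_mxT !map_mx1 !(map_mx_emb (emb' := cst)).
  by rewrite [RHS]mxE.
move=> E1.
have detW : \det LW != 0.
  apply: contraNneq (expf_neq0 (k * s * d) D0n) => det0.
  by rewrite -det_scalar -WM det_mulmx det0 mul0r.
apply: (mulfI detW).
have adjM : D0 *: \adj LW = \det LW *: M.
  by rewrite -[RHS]mul_scalar_mx -mul_adj_mx -mulmxA WM mul_mx_scalar.
have E2 : D0 * (C *m \adj LW *m B) i j = \det LW * (C *m M *m B) i j.
  have := congr1 (fun Y => (C *m Y *m B) i j) adjM.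
  by rewrite -!scalemxAr -!scalemxAl [X in X = _]mxE [X in _ = X]mxE.
by rewrite mulrCA -E2 mulrCA E1 mulrCA.
Qed.

End RegularityDomain.

Theorem corollary5p9 (F : fieldType) (charF0 : [pchar F] =i pred0)
    (g : nat) (rr : ncratfun F g)
    (m : nat) (m_gt0 : (0 < m)%N) (p : 'I_g -> 'M[F]_m) (dom_p : ncdom rr p)
    (n : nat) (c : 'rV['M[F]_m]_n) (A : 'I_g -> 'M[gseries F g m]_n)
    (b : 'cV['M[F]_m]_n)
    (real_cAb : realization rr p c A b) (red_cAb : totally_reduced c A b)
    (s : nat) (s_gt0 : (0 < s)%N) (q : 'I_g -> 'M[F]_(s * m)) :
  ncedom_st rr q <->
  \det (1%:M - \sum_(j < g) gsubst_mx A j (q j - iota_mx s (p j))) != 0.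
Proof.
have [r0 [S [rr0 [v r0p] expS reprS]]] := real_cAb.
have homA := reprS.1; have SE := flat_realization homA reprS.
have obs := flat_observable homA red_cAb; have ctr := flat_controllable homA red_cAb.
rewrite (flat_pencil_unit A (fun k => q k - iota_mx s (p k))).
set X := flat_letter A in SE obs ctr *.
have -> : pencil idfun X (fun l => tblock (q l.1.2 - iota_mx s (p l.1.2)) l.1.1 l.2) =
    pencil idfun X (local_coord idfun p q).
  congr pencil; apply/funext => -[[u k] w].
  by rewrite local_coordE map_mx_id.
split=> [[r rrr [_ rq]]|Lq].
  have req : requiv r0 r.
    (* Equivalence is defined through a fixed member rb of the class. *)
    have [rb rbn rbP] := rep_class rr.
    apply: (requiv_trans charF0 rbn); first by have [_] := (rbP _).1 rr0.
    by have [_] := (rbP _).1 rrr.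
  apply: (pencil_unit _ m_gt0 obs ctr) => k k_gt0 W M D.
  apply: (regular_on_curves m_gt0 r0p expS SE charF0 _ s_gt0 k_gt0 req (rq k k_gt0)).
  by move=> a; rewrite /= /horner_eval !hornerC.
exists r0 => //; split=> [|k k_gt0].
  exact: (edom_of_unit m_gt0 r0p expS SE).
apply/(edom_cast (mulnA k s m)); apply: (edom_of_unit m_gt0 r0p expS SE).
  by rewrite muln_gt0 k_gt0.
have -> : pencil idfun X (local_coord idfun p
      (fun j => castmx (mulnA k s m, mulnA k s m) (iota_mx k (q j)))) =
    castmx (mulnA k s _, mulnA k s _) (1%:M *t pencil idfun X (local_coord idfun p q)).
  rewrite -pencil_cast; congr pencil; apply/funext => l.
  exact: local_coord_cast.
rewrite unitmx_cast.
have /mulmx1_unit[] // : (1%:M *t pencil idfun X (local_coord idfun p q)) *m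
   (1%:M *t invmx (pencil idfun X (local_coord idfun p q))) = 1%:M :> 'M_(k * _).
by rewrite tensmx_mul mulmx1 mulmxV // tensmx11.
Qed.
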